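(* Assume (A) every multiple zeta value $\zeta(k_1,\dots,k_n)$ (admissible index, weight $k=k_1+\dots+k_n$, depth $n$) lies in $\mathrm{span}_{\mathbb{Q}}S'_{k,n}$; and (B) for every index $\mathbf{k}=(k_1,\dots,k_n)\in\mathbb{N}^n$ of weight $k=|\mathbf{k}|$, $\mathrm{Cl}_{\mathbf{k}}(\pi/3)\in\mathrm{span}_{\mathbb{Q}}S^o_{k,n}$ and $\mathrm{Gl}_{\mathbf{k}}(\pi/3)\in\mathrm{span}_{\mathbb{Q}}S^e_{k,n}$. Then for every $\mathbf{k}=(k_1,\dots,k_n)\in\mathbb{N}^n$ and $\mathbf{l}\in(\mathbb{Z}_{\ge0})^n$ with $k_u-1-l_u\ge0$ for all $u$, setting $d=\sum_{u}(k_u-1-l_u)$: if $d$ is odd then $\mathrm{Ls}_{\mathbf{k}}^{\mathbf{l}}(\pi/3)\in\mathrm{span}_{\mathbb{Q}}S^o_{|\mathbf{k}|,d}$, and if $d$ is even then $\mathrm{Ls}_{\mathbf{k}}^{\mathbf{l}}(\pi/3)\in\mathrm{span}_{\mathbb{Q}}S^e_{|\mathbf{k}|,d}$.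
   Context: $A(\theta)=\log|2\sin(\theta/2)|$; $\mathrm{Ls}_{\mathbf{k}}^{\mathbf{l}}(\sigma)=(-1)^n\int_0^{\sigma}\int_0^{\theta_n}\cdots\int_0^{\theta_2}\prod_{u=1}^n\theta_u^{l_u}A(\theta_u)^{k_u-1-l_u}\,d\theta_1\cdots d\theta_n$, $\mathrm{Ls}_\emptyset^\emptyset=1$; $|\mathbf{k}|=\sum k_u$. An index is admissible if its last entry is $\ge2$ (the empty index is admissible). $\zeta(k_1,\dots,k_n)=\sum_{0<m_1<\dots<m_n}m_1^{-k_1}\cdots m_n^{-k_n}$, $\zeta(\emptyset)=1$. $\mathrm{Li}_{k_1,\dots,k_n}(z)=\sum_{0<m_1<\dots<m_n}\frac{z^{m_n}}{m_1^{k_1}\cdots m_n^{k_n}}$ (continued holomorphically to $\mathbb{C}\setminus[1,\infty)$ and to $|z|=1$, $z\ne1$), $\mathrm{Li}_\emptyset=1$. $\mathrm{Cl}_{\mathbf{k}}(\sigma)=\mathrm{Im}\,\mathrm{Li}_{\mathbf{k}}(e^{i\sigma})$ if $|\mathbf{k}|$ even, $\mathrm{Re}$ if odd; $\mathrm{Gl}_{\mathbf{k}}(\sigma)=\mathrm{Re}\,\mathrm{Li}_{\mathbf{k}}(e^{i\sigma})$ if $|\mathbf{k}|$ even, $\mathrm{Im}$ if odd. For $k_u\ge2$, $\mathrm{SLs}(k_1,\dots,k_n)=\int_0^{\pi/3}\int_0^{\theta_n}\cdots\int_0^{\theta_2}\prod_{u=1}^n(\theta_u-\pi/3)^{k_u-2}A(\theta_u)\,d\theta_1\cdots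 d\theta_n$, $\mathrm{SLs}(\emptyset)=1$. For $k,d\ge0$: $S'_{k,d}=\{\pi^{2m}\mathrm{SLs}(k_1,\dots,k_n): 2m+\sum k_i=k,\ m\ge0,\ 0\le n\le d,\ k_i\ge3\text{ odd}\}$; $S^o_{k,d}=\{\pi^m\mathrm{SLs}(k_1,\dots,k_n): m+\sum k_i=k,\ m\ge0,\ 0\le n\le d,\ n\text{ odd},\ k_i\ge2\}$; $S^e_{k,d}$ is the same with $n$ even. *)

(* Defs.v *)
From HB Require Import structures.
From mathcomp Require Import all_boot all_order all_algebra.
From mathcomp Require Import all_classical all_reals all_analysis.
Set Implicit Arguments. Unset Strict Implicit. Unset Printing Implicit Defensive.
Import Order.TTheory GRing.Theory Num.Theory.
Import numFieldNormedType.Exports.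
Local Open Scope classical_set_scope.
Local Open Scope ring_scope.

Section Defs.
Variable R : realType.

Definition Afun (t : R) : R := ln (`| 2 * sin (t / 2) |).

(* Iterated (Lebesgue) integral, list given outermost-first:
   iter_int_rev [:: f_n; ...; f_1] s
     = \int_0^s f_n(t_n) \int_0^{t_n} f_{n-1}(t_{n-1}) ... \int_0^{t_2} f_1(t_1). *)
Fixpoint iter_int_rev (fs : seq (R -> R)) (s : R) : R :=
  match fs with
  | [::] => 1
  | f :: fs' =>
      \int[@lebesgue_measure R]_(t in `[0%R, s]) (f t * iter_int_rev fs' t)
  end.

Definition iter_int (fs : seq (R -> R)) (s : R) : R := iter_int_rev (rev fs) s.

Definition Ls (ks ls : seq nat) (s : R) : R :=
  (-1) ^+ size ks *
  iter_int [seq (fun t : R => t ^+ kl.2 * Afun t ^+ (kl.1 - 1 - kl.2)%N)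
           | kl <- zip ks ls] s.

(* SLs(k_1,...,k_n) (used only with all k_u >= 2) *)
Definition SLs (ks : seq nat) : R :=
  iter_int [seq (fun t : R => (t - pi / 3) ^+ (k - 2)%N * Afun t) | k <- ks]
           (pi / 3).

(* Truncated nested harmonic sums, index list given last-entry-first:
   zt_rev [:: k_n; ...; k_1] N = \sum_{0 < m_1 < ... < m_n < N} 1/(m_1^k_1 ... m_n^k_n). *)
Fixpoint zt_rev (ks : seq nat) (N : nat) : R :=
  match ks with
  | [::] => 1
  | k :: ks' => \sum_(1 <= m < N) (m%:R ^- k * zt_rev ks' m)
  end.

Definition mzv (ks : seq nat) : R := limn (zt_rev (rev ks)).

Definition admissible (ks : seq nat) : bool := (2 <= last 2 ks)%N.

(* Real and imaginary parts of Li_k(e^{i s}) = \sum_{0<m_1<...<m_n}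
   e^{i m_n s}/(m_1^k_1 ... m_n^k_n), as the limit of partial sums in m_n. *)
Definition Li_re (ks : seq nat) (s : R) : R :=
  match rev ks with
  | [::] => 1
  | k :: ks' =>
      limn (fun N : nat => \sum_(1 <= m < N)
              (cos (m%:R * s) * m%:R ^- k * zt_rev ks' m))
  end.

Definition Li_im (ks : seq nat) (s : R) : R :=
  match rev ks with
  | [::] => 0
  | k :: ks' =>
      limn (fun N : nat => \sum_(1 <= m < N)
              (sin (m%:R * s) * m%:R ^- k * zt_rev ks' m))
  end.

Definition Cl (ks : seq nat) (s : R) : R :=
  if odd (sumn ks) then Li_re ks s else Li_im ks s.
Definition Gl (ks : seq nat) (s : R) : R :=
  if odd (sumn ks) then Li_im ks s else Li_re ks s.

Definition S'_set (k d : nat) (x : R) : Prop :=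
  exists (m : nat) (js : seq nat),
    [/\ x = pi ^+ (2 * m) * SLs js, (2 * m + sumn js)%N = k,
        (size js <= d)%N & all (fun j => odd j && (3 <= j)%N) js].

Definition So_set (k d : nat) (x : R) : Prop :=
  exists (m : nat) (js : seq nat),
    [/\ x = pi ^+ m * SLs js, (m + sumn js)%N = k,
        (size js <= d)%N, odd (size js) & all (fun j => (2 <= j)%N) js].

Definition Se_set (k d : nat) (x : R) : Prop :=
  exists (m : nat) (js : seq nat),
    [/\ x = pi ^+ m * SLs js, (m + sumn js)%N = k,
        (size js <= d)%N, ~~ odd (size js) & all (fun j => (2 <= j)%N) js].

Definition inspanQ (P : R -> Prop) (x : R) : Prop :=
  exists s : seq (rat * R),
    (forall p, p \in s -> P p.2) /\ x = \sum_(p <- s) ratr p.1 * p.2.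

End Defs.

(* Main.v *)
(* With A = log|2 sin(t/2)|, one has Li_1(e^(it)) = - A(t) + i (pi - t) / 2 for
   0 < t < pi, and multiplying by Li_1 sends Li_w to a sum of polylogarithms
   (shuffle product with one letter).  As d/dt Li_(x0 w)(e^(it)) = i Li_w(e^(it)),
   integrating by parts step by step writes an iterated log-sine integral, times
   a power of i, as a combination of terms c (it)^b Li_w(e^(it)), where c is a
   rational polynomial in i pi and in multiple zeta values, homogeneous for the
   weight.  At t = pi/3 the hypotheses apply to each factor, products of values
   SLs are expanded by the shuffle product, and the parity of the depth is read
   off from the real or imaginary part and the weight. *)
Require Import Defs.
From HB Require Import structures.
From mathcomp Require Import all_boot all_order all_algebra.
From mathcomp Require Import all_classical all_reals all_analysis.
From mathcomp Require Import measurable_realfun ring lra zify complex.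
Set Implicit Arguments. Unset Strict Implicit. Unset Printing Implicit Defensive.
Import Order.TTheory GRing.Theory Num.Theory.
Import numFieldNormedType.Exports.
Local Open Scope classical_set_scope.
Local Open Scope ring_scope.

(** The obstacle is convergence on the unit circle: a series whose outermost form is dz/(1-z)
    converges there only conditionally. Its tails are controlled by summation by parts, locally
    uniformly in [t], and the shuffle identity, proved on coefficients, is carried over to values
    through Cesaro means. The letter dz/z in front restores absolute convergence up to [t = 0];
    primitives only involve such words, and their constants of integration, values at [t = 0], are
    where the multiple zeta values come in. Identities between iterated integrals are never computed
    by integration: two functions with equal derivatives on ]0, pi/2[ and limit 0 at 0+ coincide, so
    the logarithmic singularity only has to be integrable. For the depth, multiplication by A costs
    one, while multiplication by [it] and integration cost nothing; hence the bound [d], the total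
    exponent of A. *)

Section Convolution.

(** * Cauchy products of sequences *)

Variable R : comNzRingType.
Implicit Types x y z : nat -> R.

Definition cconv x y (m : nat) : R := \sum_(i < m.+1) x i * y (m - i)%N.

(** Truncation to polynomials hands commutativity and associativity over to the ring of
    polynomials. *)
Lemma cconv_poly N x y m : (m < N)%N ->
  cconv x y m = (\poly_(i < N) x i * \poly_(i < N) y i)`_m.
Proof.
move=> mN; rewrite coefM; apply: eq_bigr => i _; rewrite !coef_poly.
have -> : (i < N)%N by apply: leq_ltn_trans mN; rewrite -ltnS.
by rewrite (leq_ltn_trans (leq_subr _ _) mN).
Qed.

Lemma cconvC x y m : cconv x y m = cconv y x m.
Proof. by rewrite !(@cconv_poly m.+1) // mulrC. Qed.

Lemma cconvA x y z m : cconv x (cconv y z) m = cconv (cconv x y) z m.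
Proof.
pose P (u : nat -> R) : {poly R} := \poly_(i < m.+1) u i.
have PP u v j : (j <= m)%N -> (P u * P v)`_j = (P (cconv u v))`_j.
  by move=> jm; rewrite [RHS]coef_poly ltnS jm (@cconv_poly m.+1).
rewrite !(@cconv_poly m.+1) // -!/(P _).
transitivity ((P x * (P y * P z))`_m).
  rewrite !coefM; apply: eq_bigr => i _; congr (_ * _).
  by rewrite PP // leq_subr.
rewrite mulrA !coefM; apply: eq_bigr => i _; congr (_ * _).
by rewrite PP // -ltnS.
Qed.

Lemma cconvCA x y z m : cconv x (cconv y z) m = cconv y (cconv x z) m.
Proof.
rewrite !cconvA; apply: eq_bigr => i _; congr (_ * _); exact: cconvC.
Qed.

Lemma eq_cconv x x' y y' m : x =1 x' -> y =1 y' -> cconv x y m = cconv x' y' m.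
Proof. by move=> ex ey; apply: eq_bigr => i _; rewrite ex ey. Qed.

Lemma cconv_sumr (I : Type) (r : seq I) x (y : I -> nat -> R) m :
  cconv x (fun n => \sum_(i <- r) y i n) m = \sum_(i <- r) cconv x (y i) m.
Proof.
rewrite /cconv exchange_big; apply: eq_bigr => j _ /=.
by rewrite mulr_sumr.
Qed.

(** Multiplying by the index is z d/dz on power series, hence a derivation. *)
Lemma cconv_leibniz x y m :
  m%:R * cconv x y m = cconv (fun i => i%:R * x i) y m
                      + cconv x (fun i => i%:R * y i) m.
Proof.
rewrite /cconv mulr_sumr -big_split; apply: eq_bigr => i _ /=.
have -> : m%:R = i%:R + (m - i)%:R :> R.
  by rewrite -natrD subnKC // -ltnS.
by ring.
Qed.

Lemma cconv_onel y m : cconv (fun=> 1) y m = \sum_(i < m.+1) y i.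
Proof.
by rewrite cconvC; apply: eq_bigr => i _; rewrite mulr1.
Qed.

Lemma sum_cconv x y N :
  \sum_(n < N.+1) cconv x y n = cconv x (fun n => \sum_(i < n.+1) y i) N.
Proof.
rewrite -cconv_onel cconvCA; apply: eq_cconv => // n; exact: cconv_onel.
Qed.

(** Partial summation is convolution with the constant sequence 1, so of two summations one can be
    given to each factor. This is the exact identity behind the Cesaro theorem on products of
    series. *)
Lemma sum_sum_cconv x y N :
  \sum_(n < N.+1) \sum_(m < n.+1) cconv x y m
  = cconv (fun n => \sum_(i < n.+1) x i) (fun n => \sum_(i < n.+1) y i) N.
Proof.
under eq_bigr do rewrite sum_cconv cconvC.
by rewrite sum_cconv cconvC.
Qed.

End Convolution.

(** * Power series coefficients of words in the forms dz/(1-z) and dz/z *)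

Section WordCoefficients.
Variable R : realType.

(* A word codes the iterated integral from 0 to z of the forms dz/(1-z)
   ([true]) and dz/z ([false]), outermost form first; [wcoef w m] is the
   coefficient of z^m in its power series.  Since [0^-1 = 0], the coefficient
   at [m = 0] of a nonempty word vanishes. *)
Fixpoint wcoef (w : seq bool) (m : nat) : R :=
  match w with
  | [::] => (m == 0%N)%:R
  | x :: w' => (if x then \sum_(q < m) wcoef w' q else wcoef w' m) / m%:R
  end.

(* A word ending in dz/z has no convergent iterated integral. *)
Definition wvalid (w : seq bool) : bool := last true w.

Lemma wcoef_cons0 x w : wcoef (x :: w) 0 = 0.
Proof. by rewrite /= invr0 mulr0. Qed.

Lemma wcoef_ge0 w m : 0 <= wcoef w m.
Proof.
elim: w m => [|x w IH] m /=; first exact: ler0n.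
by apply: divr_ge0; [case: x => //; exact: sumr_ge0|exact: ler0n].
Qed.

(** Shuffle product of the letter dz/(1-z) with [w]; repetitions in the list are the
    multiplicities. *)
Fixpoint wshuffle1 (w : seq bool) : seq (seq bool) :=
  match w with
  | [::] => [:: [:: true]]
  | y :: v => (true :: w) :: [seq y :: u | u <- wshuffle1 v]
  end.

(** [size] is the weight of a word and [count id] its depth. *)
Lemma wshuffle1_spec w v : wvalid w -> v \in wshuffle1 w ->
  [/\ wvalid v, v != [::], size v = (size w).+1
    & count id v = (count id w).+1].
Proof.
elim: w v => [|y w IH] v /=; first by rewrite inE => _ /eqP ->.
move=> vw; rewrite inE => /predU1P[->|/mapP[u uw ->]].
  by split => //=; rewrite add1n.
have vw' : wvalid w by case: (w) vw.
have [vu u0 su cu] := IH u vw' uw.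
split=> //=; last by rewrite cu addnS.
  by case: (u) vu u0.
by rewrite su.
Qed.

(** Coefficients of z/(1-z), the factor produced when z d/dz meets the form dz/(1-z). *)
Let step (m : nat) : R := (m != 0%N)%:R.

Lemma mul_wcoef_true w m : m%:R * wcoef (true :: w) m = cconv step (wcoef w) m.
Proof.
rewrite cconvC /cconv big_ord_recr /= subnn mulr0 addr0.
case: m => [|m]; first by rewrite !big_ord0 mul0r.
rewrite mulrC divfK ?pnatr_eq0 //; apply: eq_bigr => i _.
by rewrite /step subn_eq0 -ltnNge ltn_ord mulr1.
Qed.

Lemma mul_wcoef_one m : m%:R * wcoef [:: true] m = step m.
Proof.
rewrite mul_wcoef_true /cconv big_ord_recr /= subnn mulr1 big1 ?add0r //.
by move=> i _; rewrite subn_eq0 leqNgt ltn_ord mulr0.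
Qed.

Lemma mul_wcoef_false w m : w != [::] ->
  m%:R * wcoef (false :: w) m = wcoef w m.
Proof.
case: w => // x w _; case: m => [|m]; first by rewrite mul0r wcoef_cons0.
by rewrite [wcoef (false :: _) _]/= mulrC divfK // pnatr_eq0.
Qed.

(** Apply z d/dz to both sides: the Leibniz rule strips the outermost form of one factor or of the
    other, which is the recursion of the shuffle. The operator is injective on coefficients of index
    [m != 0]; at [m = 0] both sides vanish for nonempty [w]. *)
Lemma wcoef_shuffle1 w m : wvalid w ->
  cconv (wcoef [:: true]) (wcoef w) m = \sum_(v <- wshuffle1 w) wcoef v m.
Proof.
elim: w m => [|y w IH] m vw.
  rewrite big_seq1 cconvC /cconv big_ord_recl subn0 [wcoef [::] _]/= mul1r.
  by rewrite [X in _ + X]big1 ?addr0 // => i _; rewrite mul0r.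
have vw' : wvalid w by case: (w) vw.
have [->|m0] := eqVneq m 0%N.
  rewrite /cconv big_ord1 wcoef_cons0 mul0r big1_seq // => v.
  by case/(wshuffle1_spec vw); case: v => // *; exact: wcoef_cons0.
have /mulfI : m%:R != 0 :> R by rewrite pnatr_eq0.
apply; rewrite cconv_leibniz [wshuffle1 _]/= big_cons big_map mulrDr.
congr (_ + _).
  rewrite [RHS]mul_wcoef_true.
  by apply: eq_cconv => // i; exact: mul_wcoef_one.
rewrite mulr_sumr; case: y vw => vw.
  under [RHS]eq_bigr do rewrite mul_wcoef_true.
  transitivity (cconv step (cconv (wcoef [:: true]) (wcoef w)) m).
    by rewrite cconvCA; apply: eq_cconv => // i; exact: mul_wcoef_true.
  by rewrite -cconv_sumr; apply: eq_cconv => // i; exact: IH.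
have w0 : w != [::] by case: (w) vw.
transitivity (cconv (wcoef [:: true]) (wcoef w) m).
  by apply: eq_cconv => // i; exact: mul_wcoef_false.
rewrite IH // !big_seq; apply: eq_bigr => v /(wshuffle1_spec vw')[_ v0 _ _].
by rewrite mul_wcoef_false.
Qed.

(** Partial sums of the series for the integral of Li_w over [0, 1]. *)
Definition wpartial (w : seq bool) (M : nat) : R :=
  \sum_(q < M) wcoef w q / q.+1%:R.

(** Summation by parts with 1/(q(q+1)) = 1/q - 1/(q+1), as the coefficients of [true :: w] are
    partial sums of those of [w] divided by the index. *)
Lemma wpartial_true w M :
  wpartial (true :: w) M + wcoef (true :: w) M = wpartial w M.
Proof.
rewrite /wpartial; elim: M => [|M IH].
  by rewrite !big_ord0 add0r wcoef_cons0.
rewrite !big_ord_recr [X in _ = X + _]/= -IH /= big_ord_recr /=.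
set s := \sum_(i < M) _; set P := \sum_(q < M) _.
move: @s => s; have [M0|] := posnP M.
  by rewrite /P M0 big_ord0 !mul0r add0r !addr0.
case: (M) P => // M' P _.
have : M'.+2%:R != 0 :> R by rewrite pnatr_eq0.
have : M'.+1%:R != 0 :> R by rewrite pnatr_eq0.
by rewrite -[M'.+2%:R]natr1 => ? ?; field; apply/andP.
Qed.

Lemma wpartial_nondecreasing w : nondecreasing_seq (wpartial w).
Proof.
apply/nondecreasing_seqP => n; rewrite /wpartial big_ord_recr lerDl.
by apply: divr_ge0; [exact: wcoef_ge0|exact: ler0n].
Qed.

Lemma wcoef_false_le w m : wcoef (false :: w) m <= wcoef w m.
Proof.
case: m => [|m]; first by rewrite wcoef_cons0 wcoef_ge0.
rewrite [wcoef (false :: _) _]/= ler_pdivrMr ?ltr0n // ler_peMr ?wcoef_ge0 //.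
by rewrite ler1n.
Qed.

(** Prefixing a letter never increases [wpartial], and the empty word gives at most 1. *)
Lemma wpartial_le1 w M : wpartial w M <= 1.
Proof.
elim: w => [|[] w IH].
- case: M => [|M]; first by rewrite /wpartial big_ord0 ler01.
  rewrite /wpartial big_ord_recl /= big1 ?addr0 ?divr1 // => i _.
  by rewrite mul0r.
- by apply: le_trans IH; rewrite -(wpartial_true w) lerDl wcoef_ge0.
- apply: le_trans IH; apply: ler_sum => i _.
  by rewrite ler_pM2r ?invr_gt0 ?ltr0n // wcoef_false_le.
Qed.

(** This gives absolute convergence on the whole circle. The 2 comes from 1/q <= 2/(q+1) for q >=
    1. *)
Lemma wcoef_false_partial w M :
  \sum_(m < M) wcoef (false :: w) m <= 2.
Proof.
have -> : 2 = 2 * 1 :> R by rewrite mulr1.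
apply: le_trans (ler_wpM2l _ (wpartial_le1 w M)) => //.
rewrite /wpartial mulr_sumr; apply: ler_sum => -[[|m] mM] _.
  by rewrite wcoef_cons0 mulr_ge0 // divr_ge0 ?wcoef_ge0.
rewrite [wcoef (false :: _) _]/= mulrCA; apply: ler_wpM2l; first exact: wcoef_ge0.
rewrite ler_pdivlMr ?ltr0n // mulrC ler_pdivrMr ?ltr0n //.
by rewrite -natrM ler_nat /=; lia.
Qed.

(** The partial sums of [wcoef w] increase, so from [m] to [N] the series grows by at least the
    partial sum at [m] times 1/m - 1/N. As [N] tends to infinity, a coefficient is bounded by a tail
    of a convergent series. *)
Lemma wcoef_true_tail w m N : (0 < m <= N)%N ->
  wcoef (true :: w) m - (\sum_(q < m) wcoef w q) / N%:R
  <= wpartial (true :: w) N - wpartial (true :: w) m.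
Proof.
move=> /andP[m0]; elim: N => [|N IH]; first by case: m m0.
rewrite leq_eqVlt => /predU1P[->|]; first by rewrite /= !subrr.
rewrite ltnS => mN; have {}IH := IH mN.
have N0 : (0 < N)%N by apply: leq_trans mN.
rewrite {1}/wpartial big_ord_recr -/(wpartial _ _) addrAC.
apply: le_trans (lerD IH (lexx _)); rewrite -addrA lerD2l /=.
set s := \sum_(q < m) _; set s' := \sum_(q < N) _.
have ss' : s <= s'.
  rewrite /s' -(subnKC mN) big_split_ord /= lerDl; apply: sumr_ge0 => *.
  exact: wcoef_ge0.
have -> : s / N.+1%:R = s / N%:R - s / N%:R / N.+1%:R.
  rewrite -natr1; have : N%:R != 0 :> R by rewrite pnatr_eq0 -lt0n.
  have : N%:R + 1 != 0 :> R by rewrite natr1 pnatr_eq0.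
  by move=> ? ?; field; apply/andP.
rewrite opprB addrC lerD2r ler_pM2r ?invr_gt0 ?ltr0n //.
by rewrite ler_pM2r ?invr_gt0 ?ltr0n.
Qed.

End WordCoefficients.

(** * Derivatives, termwise differentiation, Cesaro means and the Dirichlet test *)

Section RealAnalysis.
Variable R : realType.
Implicit Types (f g F : R -> R) (x e u v : nat -> R).

Lemma is_derive_ext f g (t d : R) : f =1 g ->
  is_derive t (1 : R) f d -> is_derive t (1 : R) g d.
Proof. by move=> /funext ->. Qed.

Lemma is_derive_add f g (t a b : R) : is_derive t (1 : R) f a ->
  is_derive t (1 : R) g b -> is_derive t (1 : R) (fun s => f s + g s) (a + b).
Proof. exact: is_deriveD. Qed.

Lemma is_derive_sub f g (t a b : R) : is_derive t (1 : R) f a ->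
  is_derive t (1 : R) g b -> is_derive t (1 : R) (fun s => f s - g s) (a - b).
Proof. exact: is_deriveB. Qed.

Lemma is_derive_mul f g (t a b : R) : is_derive t (1 : R) f a ->
  is_derive t (1 : R) g b ->
  is_derive t (1 : R) (fun s => f s * g s) (f t * b + a * g t).
Proof.
by move=> df dg; apply: is_derive_eq; rewrite /GRing.scale /= [a * _]mulrC.
Qed.

Lemma is_derive_scale f (k t a : R) : is_derive t (1 : R) f a ->
  is_derive t (1 : R) (fun s => k * f s) (k * a).
Proof.
exact: is_deriveZ.
Qed.

Lemma is_derive_comp f g (t a b : R) : is_derive (g t) (1 : R) f a ->
  is_derive t (1 : R) g b -> is_derive t (1 : R) (fun s => f (g s)) (a * b).
Proof. exact: is_derive1_comp. Qed.

Lemma is_derive_affine (k c t : R) : is_derive t (1 : R) (fun s => k * s + c) k.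
Proof.
by apply: is_derive_eq; rewrite addr0 /GRing.scale /= mulr1.
Qed.

Lemma is_derive_psum n (h : nat -> R -> R) (dh : nat -> R) (t : R) :
  (forall i, is_derive t (1 : R) (h i) (dh i)) ->
  is_derive t (1 : R) (fun s => \sum_(i < n) h i s) (\sum_(i < n) dh i).
Proof.
move=> dhP; elim: n => [|n IH].
  rewrite big_ord0; apply: is_derive_ext (is_derive_cst 0 t 1) => s.
  by rewrite big_ord0.
rewrite big_ord_recr /=.
apply: is_derive_ext (is_derive_add IH (dhP n)) => s.
by rewrite big_ord_recr.
Qed.

Lemma is_derive_dist F (t d : R) :
  (forall e : R, 0 < e -> exists2 r : R, 0 < r & forall y, `|y - t| < r ->
     `|F y - F t - d * (y - t)| <= e * `|y - t|) ->
  is_derive t (1 : R) F d.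
Proof.
move=> H.
have L : (fun h : R => h^-1 *: ((F \o shift t) (h *: (1 : R)) - F t)) @ 0^' --> d.
  apply/cvgrPdist_le => e e0; have [r r0 Hr] := H e e0.
  rewrite near_withinE; exists r => //= h; rewrite /= sub0r normrN => hr h0.
  have := Hr (h + t); rewrite addrK => /(_ hr) {}Hr.
  rewrite /GRing.scale /= mulr1.
  have -> : d - h^-1 * (F (h + t) - F t) = - (F (h + t) - F t - d * h) / h.
    by field.
  by rewrite normrM normrN normfV ler_pdivrMr ?normr_gt0.
apply: DeriveDef; first by apply/cvg_ex; exists d.
exact: cvg_lim L.
Qed.

Lemma dist_is_derive F (t d e : R) : is_derive t (1 : R) F d -> 0 < e ->
  exists2 r : R, 0 < r & forall y, `|y - t| < r ->
     `|F y - F t - d * (y - t)| <= e * `|y - t|.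
Proof.
case=> /[swap] <- Fd e0; move: (Fd) => /cvgrPdist_le /(_ e e0).
rewrite near_withinE => -[r /= r0 Hr]; exists r => // y yt.
have [->|ny] := eqVneq y t; first by rewrite !subrr mulr0 subrr normr0 mulr0.
have h0 : y - t != 0 by rewrite subr_eq0.
have := Hr (y - t); rewrite /= sub0r normrN => /(_ yt h0).
rewrite -/('D_1 F t) /GRing.scale /= mulr1 subrK.
set D := 'D_1 F t; set h := y - t in h0 *.
have -> : D - h^-1 * (F y - F t) = - (F y - F t - D * h) / h by field.
by rewrite normrM normrN normfV ler_pdivrMr ?normr_gt0.
Qed.

Lemma is_derive_continuous f (t d : R) : is_derive t (1 : R) f d ->
  {for t, continuous f}.
Proof.
by move=> [fd _]; apply: differentiable_continuous; apply/derivable1_diffP.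
Qed.

Lemma MVT_dist f (df : R -> R) (a b K : R) :
  (forall t, a < t < b -> is_derive t (1 : R) f (df t)) ->
  (forall t, a < t < b -> `|df t| <= K) ->
  forall s t, a < s < b -> a < t < b -> `|f t - f s| <= K * `|t - s|.
Proof.
move=> fd fK.
suff H s t : a < s < b -> a < t < b -> s < t -> `|f t - f s| <= K * `|t - s|.
  move=> s t sab tab; have [st|ts|->] := ltgtP s t; first exact: H.
    by rewrite distrC [`|t - s|]distrC; exact: H.
  by rewrite !subrr normr0 mulr0.
move=> /andP[as_ sb] /andP[at_ tb] st.
have sub y : s <= y <= t -> a < y < b.
  by move=> /andP[sy yt]; rewrite (lt_le_trans as_ sy) (le_lt_trans yt tb).
have fd' y : y \in `]s, t[ -> is_derive y (1 : R) f (df y).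
  rewrite in_itv /= => /andP[sy yt]; apply: fd; apply: sub.
  by rewrite !ltW.
have fc : {within `[s, t], continuous f}.
  apply: derivable_within_continuous => y; rewrite in_itv /= => yst.
  by have [] := fd y (sub y yst).
have [c cst ->] := MVT st fd' fc.
rewrite normrM; apply: ler_wpM2r => //; apply: fK; apply: sub.
by move: cst; rewrite in_itv /= => /andP[sy yt]; rewrite !ltW.
Qed.

Lemma derive_zero_eq0 f (b : R) :
  (forall t, 0 < t < b -> is_derive t (1 : R) f 0) ->
  f t @[t --> 0^'+] --> 0 -> forall t, 0 < t < b -> f t = 0.
Proof.
move=> fd f0 t /andP[t0 tb].
have E s : 0 < s -> s < b -> f s = f t.
  move=> s0 sb; apply/eqP; rewrite -subr_eq0 -normr_le0.
  have := @MVT_dist f (fun=> 0) 0 b 0 fd _ t s; rewrite mul0r; apply.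
  - by move=> *; rewrite normr0.
  - by rewrite t0.
  - by rewrite s0.
apply/esym; apply: (cvg_unique _ f0) => //.
apply: cvg_near_cst; near=> s; apply: E; first by near: s; exact: nbhs_right_gt.
near: s; apply: nbhs_right_lt; exact: lt_trans tb.
Unshelve. all: by end_near. Qed.

Lemma cvg_bigsum (I : Type) (r : seq I) (u : I -> nat -> R) (l : I -> R) :
  (forall i, u i n @[n --> \oo] --> l i) ->
  \sum_(i <- r) u i n @[n --> \oo] --> \sum_(i <- r) l i.
Proof.
move=> ul; elim: r => [|i r IH].
  rewrite big_nil; under eq_fun do rewrite big_nil; exact: cvg_cst.
rewrite big_cons; under eq_fun do rewrite big_cons; exact: cvgD.
Qed.

Lemma cauchy_tail x e :
  (forall M N, (M <= N)%N -> `|x N - x M| <= e M) -> e n @[n --> \oo] --> 0 ->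
  cvgn x /\ forall M, `|limn x - x M| <= e M.
Proof.
move=> xe e0.
have cx : cvgn x.
  apply/cauchy_cvgP/cauchy_exP => r r0.
  have /cvgrPdist_lt /(_ r r0) [M _ HM] := e0.
  exists (x M); exists M => // N /= MN; rewrite /ball /= distrC.
  apply: le_lt_trans (xe _ _ MN) _.
  by have := HM M (leqnn M); rewrite /= sub0r normrN; apply: le_lt_trans; exact: ler_norm.
split=> // M.
have H : `|x n - x M| @[n --> \oo] --> `|limn x - x M|.
  by apply: cvg_norm; apply: cvgB => //; exact: cvg_cst.
apply: (cvgr_to_le H); exists M => // N /= MN; exact: xe.
Qed.

(** The mean value inequality for [f m - f n], with [m] tending to infinity, bounds the increments
    of [F - f n] by [e n] times the step. A single [n] with [e n <= r / 4] then suffices: three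
    errors of size [r / 4] stay below [r]. *)
Lemma termwise_derive (f df : nat -> R -> R) F (dF : R -> R) e (a b : R) :
  (forall n t, a < t < b -> is_derive t (1 : R) (f n) (df n t)) ->
  (forall n t, a < t < b -> `|df n t - dF t| <= e n) ->
  e n @[n --> \oo] --> 0 ->
  (forall t, a < t < b -> f n t @[n --> \oo] --> F t) ->
  forall t, a < t < b -> is_derive t (1 : R) F (dF t).
Proof.
move=> fd dfe e0 fF t tab.
have key n y : a < y < b ->
    `|F y - F t - (f n y - f n t)| <= e n * `|y - t|.
  move=> yab.
  have L1 : `|(f m y - f m t) - (f n y - f n t)| @[m --> \oo]
      --> `|F y - F t - (f n y - f n t)|.
    apply: cvg_norm; apply: cvgB; last exact: cvg_cst.
    by apply: cvgB; exact: fF.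
  have L2 : (e n + e m) * `|y - t| @[m --> \oo] --> (e n + 0) * `|y - t|.
    by apply: cvgM; [apply: cvgD => //; exact: cvg_cst|exact: cvg_cst].
  rewrite -[X in X * _]addr0; apply: (ler_cvg_to L1 L2).
  apply: nearW => m.
  have := @MVT_dist (fun s => f m s - f n s) (fun s => df m s - df n s) a b
    (e n + e m) _ _ t y tab yab.
  have -> : f m y - f n y - (f m t - f n t) = f m y - f m t - (f n y - f n t).
    by ring.
  apply.
    by move=> s sab; apply: is_derive_sub; exact: fd.
  move=> s sab.
  have -> : df m s - df n s = (df m s - dF s) - (df n s - dF s) by ring.
  apply: le_trans (ler_normB _ _) _; rewrite addrC.
  by apply: lerD; exact: dfe.
apply: is_derive_dist => r r0.
have r40 : 0 < r / 4 by rewrite divr_gt0.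
have /cvgrPdist_lt /(_ _ r40) [n _ /(_ n (leqnn n))] := e0.
rewrite /= sub0r normrN => en.
have {}en : e n <= r / 4 by apply: le_trans (ler_norm _) (ltW en).
have [q q0 Hq] := dist_is_derive (fd n t tab) r40.
case/andP: (tab) => at_ tb.
exists (Num.min q (Num.min (t - a) (b - t))).
  by rewrite !lt_min q0 !subr_gt0 at_ tb.
move=> y; rewrite !lt_min => /and3P[yq ya yb].
have yab : a < y < b.
  have := ler_norm (y - t); have := ler_norm (- (y - t)); rewrite normrN.
  by move=> *; apply/andP; split; lra.
have -> : F y - F t - dF t * (y - t) = (F y - F t - (f n y - f n t))
   + (f n y - f n t - df n t * (y - t)) + (df n t - dF t) * (y - t) by ring.
have H1 := key n y yab; have H2 := Hq y yq.
have H3 : `|(df n t - dF t) * (y - t)| <= e n * `|y - t|.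
  by rewrite normrM; apply: ler_wpM2r => //; exact: dfe.
apply: le_trans (ler_normD _ _) _; apply: le_trans (lerD (ler_normD _ _) (lexx _)) _.
have y0 : 0 <= r * `|y - t| by rewrite mulr_ge0 // ltW.
have H4 : e n * `|y - t| <= r / 4 * `|y - t| by apply: ler_wpM2r.
lra.
Qed.

(** Write [u] as [a] plus a null sequence: the constant gives the mean of [v], and the rest is at
    most a bound of [v] times the mean of [|u - a|]. *)
Lemma cvg_mean_mul u v (a b : R) :
  u n @[n --> \oo] --> a -> v n @[n --> \oo] --> b ->
  n.+1%:R^-1 * cconv u v n @[n --> \oo] --> a * b.
Proof.
move=> ua vb.
have [V HV] : exists V : R, forall n, `|v n| <= V.
  have /cvg_seq_bounded [M [_ HM]] : cvgn v by apply/cvg_ex; exists b.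
  by exists (M + 1) => n; apply: (HM (M + 1)) => //; rewrite ltrDl.
have Lv := cesaro vb.
have Le : arithmetic_mean (fun n => `|u n - a|) n @[n --> \oo] --> 0.
  apply: cesaro; rewrite -(normr0 R); apply: cvg_norm; rewrite -(subrr a).
  by apply: cvgB => //; exact: cvg_cst.
have E n : n.+1%:R^-1 * cconv u v n = a * arithmetic_mean v n
    + n.+1%:R^-1 * cconv (fun i => u i - a) v n.
  rewrite /arithmetic_mean /= /series /= big_mkord mulrCA -mulrDr; congr (_ * _).
  rewrite -cconv_onel mulr_sumr -big_split; apply: eq_bigr => i _ /=.
  by ring.
rewrite -[a * b]addr0; under eq_fun do rewrite E.
apply: cvgD; first by apply: cvgM => //; exact: cvg_cst.
have L2 : V * arithmetic_mean (fun n => `|u n - a|) n @[n --> \oo] --> 0.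
  by rewrite -(mulr0 V); apply: cvgM => //; exact: cvg_cst.
have L1 : - (V * arithmetic_mean (fun n => `|u n - a|) n) @[n --> \oo] --> 0.
  by rewrite -oppr0; exact: cvgN.
apply: squeeze_cvgr L1 L2; apply: nearW => n; rewrite -ler_norml.
rewrite normrM ger0_norm ?invr_ge0 // /arithmetic_mean /= /series /= mulrCA.
apply: ler_wpM2l; first by rewrite invr_ge0.
apply: le_trans (ler_norm_sum _ _ _) _; rewrite big_mkord mulr_sumr.
apply: ler_sum => i _; rewrite normrM mulrC; exact: ler_wpM2r.
Qed.

(** Absolute convergence of neither series is assumed, hence the conclusion in the mean only. *)
Lemma cvg_cauchy_product (x y : nat -> R) (a b : R) :
  \sum_(i < n.+1) x i @[n --> \oo] --> a ->
  \sum_(i < n.+1) y i @[n --> \oo] --> b ->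
  arithmetic_mean (fun n => \sum_(m < n.+1) cconv x y m) n @[n --> \oo]
    --> a * b.
Proof.
move=> xa yb; have := cvg_mean_mul xa yb.
under eq_fun do rewrite -sum_sum_cconv.
by rewrite /arithmetic_mean /series /=; under [in X in _ -> X]eq_fun do rewrite big_mkord.
Qed.

(** Abel summation: the boundary terms contribute [b N + b M] and the decrements telescope to
    [b M - b N], in all [2 * b M] whatever [N] is. *)
Lemma dirichlet_bound x (S b : nat -> R) (s : R) : 0 < s ->
  (forall m, s * x m = S m.+1 - S m) -> (forall m, `|S m| <= 1) ->
  (forall m, 0 <= b m) -> nonincreasing_seq b ->
  forall M N, (M <= N)%N -> `|\sum_(M <= m < N) b m * x m| <= 2 * b M / s.
Proof.
move=> s0 xS S1 b0 bn M N MN.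
have E : s * (\sum_(M <= m < N) b m * x m)
    = b N * S N - b M * S M + \sum_(M <= m < N) (b m - b m.+1) * S m.+1.
  elim: N MN => [|N IH]; first by rewrite leqn0 => /eqP ->; rewrite !big_geq // mulr0 subrr addr0.
  rewrite leq_eqVlt => /predU1P[->|]; first by rewrite !big_geq // mulr0 subrr addr0.
  rewrite ltnS => MN; rewrite !big_nat_recr //= mulrDr IH // mulrCA xS.
  by ring.
have B : `|\sum_(M <= m < N) (b m - b m.+1) * S m.+1| <= b M - b N.
  apply: le_trans (ler_norm_sum _ _ _) _.
  rewrite -opprB -(telescope_sumr b MN) -sumrN.
  apply: ler_sum => m _; rewrite opprB normrM ger0_norm; last by rewrite subr_ge0 bn.
  by rewrite ler_piMr // subr_ge0 bn.
rewrite ler_pdivlMr // mulrC -[X in X * _]gtr0_norm // -normrM E.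
have B1 : `|b N * S N| <= b N by rewrite normrM ger0_norm // ler_piMr.
have B2 : `|b M * S M| <= b M by rewrite normrM ger0_norm // ler_piMr.
apply: le_trans (ler_normD _ _) _; apply: le_trans (lerD (ler_normB _ _) B) _.
lra.
Qed.

End RealAnalysis.

(** * Polylogarithms on the unit circle, through phase-shifted cosine series *)

Section CirclePolylog.
Variable R : realType.
Implicit Types (w : seq bool) (p t : R).

Definition Lpart p w t (N : nat) : R :=
  \sum_(m < N) wcoef R w m * cos (m%:R * t + p).

(* [Lphase p w t] is the real part of [e^(ip) Li_w(e^(it))]: differentiation
   in [t] shifts the phase [p] by [pi / 2]. *)
Definition Lphase p w t : R := limn (Lpart p w t).

Lemma LpartS p w t N :
  Lpart p w t N.+1 = Lpart p w t N + wcoef R w N * cos (N%:R * t + p).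
Proof. by rewrite /Lpart big_ord_recr. Qed.

Lemma Lpart_sub p w t M N : (M <= N)%N ->
  Lpart p w t N - Lpart p w t M
  = \sum_(M <= m < N) wcoef R w m * cos (m%:R * t + p).
Proof.
move=> MN; rewrite /Lpart -!(big_mkord xpredT (fun m => wcoef R w m * cos (m%:R * t + p))).
by rewrite (big_cat_nat (leq0n M) MN) //= addrAC subrr add0r.
Qed.

Lemma wabs_tail w (K : R) : (forall N, \sum_(m < N) wcoef R w m <= K) ->
  exists e : nat -> R, [/\ forall M, 0 <= e M, e n @[n --> \oo] --> 0 &
    forall p t M N, (M <= N)%N -> `|Lpart p w t N - Lpart p w t M| <= e M].
Proof.
move=> wK; pose P N := \sum_(m < N) wcoef R w m.
have Pn : nondecreasing_seq P.
  by apply/nondecreasing_seqP => n; rewrite /P big_ord_recr lerDl wcoef_ge0.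
have Pc : cvgn P.
  apply: nondecreasing_is_cvgn => //; exists K => _ [n _ <-]; exact: wK.
exists (fun M => limn P - P M); split.
- by move=> M; rewrite subr_ge0; exact: nondecreasing_cvgn_le.
- by rewrite -(subrr (limn P)); apply: cvgB => //; exact: cvg_cst.
move=> p t M N MN; rewrite Lpart_sub //.
apply: le_trans (ler_norm_sum _ _ _) _.
apply: (@le_trans _ _ (P N - P M)); last by rewrite lerD2r; exact: nondecreasing_cvgn_le.
rewrite /P -!(big_mkord xpredT (wcoef R w)) (big_cat_nat (leq0n M) MN) //= addrAC subrr add0r.
apply: ler_sum => m _; rewrite normrM (ger0_norm (wcoef_ge0 _ _ _)).
by rewrite ler_piMr ?wcoef_ge0 ?cos_max.
Qed.

Lemma wfalse_tail w :
  exists e : nat -> R, [/\ forall M, 0 <= e M, e n @[n --> \oo] --> 0 &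
    forall p t M N, (M <= N)%N ->
      `|Lpart p (false :: w) t N - Lpart p (false :: w) t M| <= e M].
Proof. by apply: (@wabs_tail _ 2) => N; exact: wcoef_false_partial. Qed.

Lemma sin_half_gt0 t : 0 < t < pi -> 0 < sin (t / 2).
Proof.
move=> /andP[t0 tpi]; apply: sin_gt0_pihalf; rewrite divr_gt0 //=.
by rewrite ltr_pM2r ?invr_gt0.
Qed.

(** Turns the cosines into differences of a bounded sequence, as [dirichlet_bound] requires. *)
Lemma sin2_cos p t (m : nat) :
  (2 * sin (t / 2)) * cos (m%:R * t + p)
  = sin (m.+1%:R * t - t / 2 + p) - sin (m%:R * t - t / 2 + p).
Proof.
have -> : m.+1%:R * t - t / 2 + p = (m%:R * t + p) + t / 2 by rewrite -natr1; field.
have -> : m%:R * t - t / 2 + p = (m%:R * t + p) - t / 2 by ring.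
by rewrite sinD sinB; ring.
Qed.

Lemma wcoef_true_cvg0 w : wcoef R (true :: w) n @[n --> \oo] --> 0.
Proof.
have Pc : cvgn (wpartial R (true :: w)).
  apply: nondecreasing_is_cvgn; first exact: wpartial_nondecreasing.
  by exists 1 => _ [n _ <-]; exact: wpartial_le1.
set P := wpartial R (true :: w) in Pc.
have L : limn P - P n @[n --> \oo] --> 0.
  by rewrite -(subrr (limn P)); apply: cvgB => //; exact: cvg_cst.
apply: (squeeze_cvgr _ (cvg_cst 0) L); exists 1%N => // m m0.
have {}m0 : (0 < m)%N := m0.
apply/andP; split; first exact: wcoef_ge0.
have L1 : wcoef R (true :: w) m - (\sum_(q < m) wcoef R w q) * harmonic N @[N --> \oo]
    --> wcoef R (true :: w) m - (\sum_(q < m) wcoef R w q) * 0.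
  by apply: cvgB; [exact: cvg_cst|apply: cvgM; [exact: cvg_cst|exact: cvg_harmonic]].
have L2 : P N.+1 - P m @[N --> \oo] --> limn P - P m.
  by apply: cvgB; [rewrite (cvg_shiftS P); exact: Pc|exact: cvg_cst].
rewrite -[leLHS]subr0 -(mulr0 (\sum_(q < m) wcoef R w q)).
apply: (ler_cvg_to L1 L2); exists m => // N /= mN.
by apply: wcoef_true_tail; rewrite m0 ltnW.
Qed.

(** The coefficients of [true :: w] need not be monotone: for two letters [true] they are the
    harmonic number of index m-1 divided by m. But [wpartial_true] makes them differences of two
    tails of convergent series with nonnegative terms, and the Dirichlet test applies to each tail.
    For the other words the bound is absolute, and dividing by a sine only weakens it. *)
Lemma wtail w :
  exists e : nat -> R, [/\ forall M, 0 <= e M, e n @[n --> \oo] --> 0 &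
    forall p t M N, 0 < t < pi -> (M <= N)%N ->
      `|Lpart p w t N - Lpart p w t M| <= e M / sin (t / 2)].
Proof.
have absP v : (exists e : nat -> R, [/\ forall M, 0 <= e M, e n @[n --> \oo] --> 0 &
    forall p t M N, (M <= N)%N -> `|Lpart p v t N - Lpart p v t M| <= e M]) ->
  exists e : nat -> R, [/\ forall M, 0 <= e M, e n @[n --> \oo] --> 0 &
    forall p t M N, 0 < t < pi -> (M <= N)%N ->
      `|Lpart p v t N - Lpart p v t M| <= e M / sin (t / 2)].
  move=> [e [e0 ec eP]]; exists e; split=> // p t M N tpi MN.
  apply: le_trans (eP p t M N MN) _; have s0 := sin_half_gt0 tpi.
  by rewrite ler_pdivlMr // ler_piMr // sin_le1.
case: w => [|[] w]; last by apply: absP; exact: wfalse_tail.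
  apply: absP; apply: (@wabs_tail _ 1) => -[|N]; first by rewrite big_ord0.
  by rewrite big_ord_recl big1 //= addr0.
set P := wpartial R w; set Q := wpartial R (true :: w).
have cvgP v : cvgn (wpartial R v).
  apply: nondecreasing_is_cvgn; first exact: wpartial_nondecreasing.
  by exists 1 => _ [n _ <-]; exact: wpartial_le1.
(* The two series have equal sums because the coefficients of [true :: w] tend to 0. *)
have QP : limn P = limn Q.
  have L : Q n + wcoef R (true :: w) n @[n --> \oo] --> limn Q + 0.
    by apply: cvgD; [exact: cvgP|exact: wcoef_true_cvg0].
  rewrite addr0 in L; apply: cvg_lim => //; apply: cvg_trans L.
  by under eq_fun do rewrite wpartial_true.
have tail v : [/\ forall M, 0 <= limn (wpartial R v) - wpartial R v M,
    nonincreasing_seq (fun M => limn (wpartial R v) - wpartial R v M) &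
    limn (wpartial R v) - wpartial R v n @[n --> \oo] --> 0].
  split.
  - move=> M; rewrite subr_ge0; apply: nondecreasing_cvgn_le => //.
    exact: wpartial_nondecreasing.
  - by move=> m n mn; rewrite lerD2l lerN2; exact: wpartial_nondecreasing.
  - rewrite -[X in _ --> X](subrr (limn (wpartial R v))); apply: cvgB; first exact: cvg_cst.
    exact: cvgP.
have [P0 Pn Pc] := tail w; have [Q0 Qn Qc] := tail (true :: w).
exists (fun M => (limn Q - Q M) + (limn P - P M)); split.
- by move=> M; rewrite addr_ge0.
- by rewrite -[X in _ --> X](addr0 0); exact: cvgD.
move=> p t M N tpi MN; rewrite Lpart_sub //.
have s0 := sin_half_gt0 tpi.
have s20 : 0 < 2 * sin (t / 2) by rewrite mulr_gt0.
have D b : (forall m, 0 <= b m) -> nonincreasing_seq b ->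
    `|\sum_(M <= m < N) b m * cos (m%:R * t + p)| <= b M / sin (t / 2).
  move=> b0 bn.
  have -> : b M / sin (t / 2) = 2 * b M / (2 * sin (t / 2)).
    by field; rewrite gt_eqF.
  apply: (@dirichlet_bound R _ (fun m => sin (m%:R * t - t / 2 + p))) => //.
  - by move=> m; exact: sin2_cos.
  - by move=> m; rewrite ler_norml sin_geN1 sin_le1.
have -> : \sum_(M <= m < N) wcoef R (true :: w) m * cos (m%:R * t + p) =
   \sum_(M <= m < N) (limn Q - Q m) * cos (m%:R * t + p)
   - \sum_(M <= m < N) (limn P - P m) * cos (m%:R * t + p).
  rewrite -sumrB; apply: eq_bigr => m _; rewrite -mulrBl; congr (_ * _).
  by rewrite QP /P -(wpartial_true R w m) -/Q; ring.
apply: le_trans (ler_normB _ _) _; rewrite mulrDl; apply: lerD; exact: D.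
Qed.

Lemma Lphase_cvg p w t : 0 < t < pi -> Lpart p w t N @[N --> \oo] --> Lphase p w t.
Proof.
move=> tpi; have [e [e0 ec eP]] := wtail w.
have [] // := @cauchy_tail R (Lpart p w t) (fun M => e M / sin (t / 2)).
  by move=> M N MN; exact: eP.
by rewrite -(mul0r (sin (t / 2))^-1); apply: cvgM => //; exact: cvg_cst.
Qed.

Lemma Lphase_false_cvg p w t :
  Lpart p (false :: w) t N @[N --> \oo] --> Lphase p (false :: w) t.
Proof.
have [e [e0 ec eP]] := wfalse_tail w.
by have [] // := @cauchy_tail R (Lpart p (false :: w) t) e (eP p t).
Qed.

Lemma Lpart_derive p w t N : w != [::] ->
  is_derive t (1 : R) ((Lpart p (false :: w))^~ N) (Lpart (p + pi / 2) w t N).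
Proof.
move=> w0.
apply: (@is_derive_psum R N
  (fun m s => wcoef R (false :: w) m * cos (m%:R * s + p))
  (fun m => wcoef R w m * cos (m%:R * t + (p + pi / 2)))) => m.
apply: is_derive_eq (is_derive_scale _ (is_derive_comp (is_derive_cos _)
  (is_derive_affine _ _ _))) _.
by rewrite addrA cosDpihalf -(mul_wcoef_false R m w0); ring.
Qed.

Lemma sin_half_le (a t : R) : 0 < a -> a <= t -> t < pi ->
  sin (a / 2) <= sin (t / 2).
Proof.
move=> a0 at_ tpi; rewrite leNgt; apply/negP.
rewrite ltr_sin ?in_itv /=; last 2 first.
- by apply/andP; split; lra.
- by apply/andP; split; lra.
by rewrite ltr_pM2r ?invr_gt0 // ltNge at_.
Qed.

Lemma Lphase_derive p w t : w != [::] -> 0 < t < pi ->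
  is_derive t (1 : R) (Lphase p (false :: w)) (Lphase (p + pi / 2) w t).
Proof.
move=> w0 /andP[t0 tpi]; have [e [e0 ec eP]] := wtail w.
have t2 : 0 < t / 2 by rewrite divr_gt0.
have s0 : 0 < sin (t / 2 / 2) by apply: sin_half_gt0; lra.
(* On ]t/2, pi[ the sine in the tail bound is at least [sin (t / 2 / 2)], which makes the bound
   uniform. *)
apply: (@termwise_derive R (fun N s => Lpart p (false :: w) s N)
  (fun N s => Lpart (p + pi / 2) w s N) _ _ (fun N => e N / sin (t / 2 / 2)) (t / 2) pi).
- by move=> N s _; exact: Lpart_derive.
- move=> N s /andP[ts spi].
  have spi' : 0 < s < pi by apply/andP; split; lra.
  have ss : 0 < sin (s / 2) := sin_half_gt0 spi'.
  rewrite distrC.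
  have ec' : e n / sin (s / 2) @[n --> \oo] --> 0.
    by rewrite -(mul0r (sin (s / 2))^-1); apply: cvgM => //; exact: cvg_cst.
  have [_ H] := cauchy_tail (fun M N => eP (p + pi / 2) s M N spi') ec'.
  apply: le_trans (H N) _.
  apply: ler_wpM2l => //; rewrite lef_pV2 ?posrE //.
  by apply: sin_half_le => //; exact: ltW.
- by rewrite -(mul0r (sin (t / 2 / 2))^-1); apply: cvgM => //; exact: cvg_cst.
- by move=> s _; exact: Lphase_false_cvg.
- by apply/andP; split; lra.
Qed.

Lemma Lphase_false_at0 p w :
  Lphase p (false :: w) t @[t --> 0^'+] --> Lphase p (false :: w) 0.
Proof.
have [e [e0 ec eP]] := wfalse_tail w.
have H t M : `|Lphase p (false :: w) t - Lpart p (false :: w) t M| <= e M.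
  by have [_ H] := @cauchy_tail R (Lpart p (false :: w) t) e (eP p t) ec; exact: H.
apply: cvg_at_right_filter; apply/cvgrPdist_le => r r0.
have r30 : 0 < r / 3 by rewrite divr_gt0.
have /cvgrPdist_lt /(_ _ r30) [N _ /(_ N (leqnn N))] := ec.
rewrite /= sub0r normrN => /ltW eN.
have {}eN : e N <= r / 3 by apply: le_trans (ler_norm _) eN.
have cP : {for 0, continuous (fun t => Lpart p (false :: w) t N)}.
  (* The word [[:: false]] has all coefficients 0, by the convention on [0^-1]. *)
  have [->|w0] := eqVneq w [::]; last exact: is_derive_continuous (Lpart_derive p 0 N w0).
  apply: cvg_near_cst; apply: nearW => t.
  rewrite /Lpart !big1 // => -[[|i] iN] _ /=; by rewrite ?invr0 ?mulr0 mul0r ?mul0r.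
have /cvgrPdist_le /(_ _ r30) := cP.
apply: filterS => t Ht.
have -> : Lphase p (false :: w) 0 - Lphase p (false :: w) t =
  (Lphase p (false :: w) 0 - Lpart p (false :: w) 0 N) +
  (Lpart p (false :: w) 0 N - Lpart p (false :: w) t N) -
  (Lphase p (false :: w) t - Lpart p (false :: w) t N) by ring.
apply: le_trans (ler_normB _ _) _; apply: le_trans (lerD (ler_normD _ _) (lexx _)) _.
have := H 0 N; have := H t N; lra.
Qed.

Lemma Lphase_nil p t : Lphase p [::] t = cos p.
Proof.
apply: cvg_lim => //; rewrite -(cvg_shiftS (Lpart p [::] t)).
apply: cvg_near_cst; apply: nearW => N /=.
rewrite /Lpart big_ord_recl /= mul1r mul0r add0r big1 ?addr0 // => i _.
by rewrite /= mul0r.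
Qed.

(** This is the real part of e^(ip) Li_1 Li_w: a shift of the phase by [- (pi / 2)] turns real parts
    into imaginary parts. The Cauchy products converge in the mean to the left-hand side; the series
    on the right converges, so its means have the same limit as its partial sums. *)
Lemma Lphase_shuffle1 p w t : wvalid w -> 0 < t < pi ->
  Lphase 0 [:: true] t * Lphase p w t
  - Lphase (- (pi / 2)) [:: true] t * Lphase (p - pi / 2) w t
  = \sum_(v <- wshuffle1 w) Lphase p v t.
Proof.
move=> vw tpi.
pose x1 m := wcoef R [:: true] m * cos (m%:R * t + 0).
pose x2 m := wcoef R [:: true] m * cos (m%:R * t - pi / 2).
pose y1 m := wcoef R w m * cos (m%:R * t + p).
pose y2 m := wcoef R w m * cos (m%:R * t + (p - pi / 2)).
have L q v : Lpart q v t n.+1 @[n --> \oo] --> Lphase q v t.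
  by rewrite (cvg_shiftS (Lpart q v t)); exact: Lphase_cvg.
have M1 := @cvg_cauchy_product R x1 y1 _ _ (L 0 [:: true]) (L p w).
have M2 := @cvg_cauchy_product R x2 y2 _ _ (L (- (pi / 2)) [:: true]) (L (p - pi / 2) w).
have M3 : (fun n => \sum_(v <- wshuffle1 w) Lpart p v t n.+1) n @[n --> \oo]
    --> \sum_(v <- wshuffle1 w) Lphase p v t.
  by apply: cvg_bigsum => v; exact: L.
have {}M3 := cesaro M3.
have E n : arithmetic_mean (fun n => \sum_(v <- wshuffle1 w) Lpart p v t n.+1) n
    = arithmetic_mean (fun n => \sum_(m < n.+1) cconv x1 y1 m) n
    - arithmetic_mean (fun n => \sum_(m < n.+1) cconv x2 y2 m) n; last first.
  apply: (cvg_unique _ (cvgB M1 M2)) => //.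
  by apply: cvg_trans M3; apply: near_eq_cvg; apply: nearW => n; exact: E.
rewrite /arithmetic_mean /= -mulrBr; congr (_ * _).
rewrite /series /= -sumrB; apply: eq_bigr => k _.
rewrite -sumrB /Lpart exchange_big; apply: eq_bigr => m _ /=.
rewrite -mulr_suml -(wcoef_shuffle1 _ _ vw) /cconv mulr_suml -sumrB.
apply: eq_bigr => i _.
have -> : m%:R * t + p = i%:R * t + ((m - i)%:R * t + p).
  by rewrite addrA -mulrDl -natrD subnKC // -ltnS.
rewrite /x1 /x2 /y1 /y2 addr0 [(m - i)%:R * t + (p - _)]addrA !cosBpihalf cosD.
by ring.
Qed.

Lemma derive_zero_cst (f : R -> R) (a b s t : R) :
  (forall u, a < u < b -> is_derive u (1 : R) f 0) ->
  a < s < b -> a < t < b -> f t = f s.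
Proof.
move=> fd sab tab; apply/eqP; rewrite -subr_eq0 -normr_le0.
have := @MVT_dist R f (fun=> 0) a b 0 fd _ s t sab tab; rewrite mul0r; apply.
by move=> *; rewrite normr0.
Qed.

Lemma sum_sin_telescope p t N :
  (2 * sin (t / 2)) * (\sum_(m < N) sin (m.+1%:R * t + p))
  = cos (t / 2 + p) - cos (N%:R * t + t / 2 + p).
Proof.
elim: N => [|N IH]; first by rewrite big_ord0 mulr0 mul0r add0r subrr.
rewrite big_ord_recr /= mulrDr IH.
have -> : N%:R * t + t / 2 + p = (N.+1%:R * t + p) - t / 2 by rewrite -natr1; field.
have -> : N.+1%:R * t + t / 2 + p = (N.+1%:R * t + p) + t / 2 by ring.
by rewrite [X in _ = _ - X]cosD cosB; ring.
Qed.

Lemma wcoef_one m : wcoef R [:: true] m = m%:R^-1.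
Proof.
case: m => [|m]; first by rewrite wcoef_cons0 invr0.
have m0 : m.+1%:R != 0 :> R by rewrite pnatr_eq0.
by apply: (mulfI m0); rewrite mul_wcoef_one mulfV.
Qed.

Lemma Lpart_one_derive p t N : 0 < t < pi ->
  is_derive t (1 : R) ((Lpart p [:: true])^~ N.+1)
    ((cos (N%:R * t + t / 2 + p) - cos (t / 2 + p)) / (2 * sin (t / 2))).
Proof.
move=> /sin_half_gt0 s0.
apply: is_derive_eq.
  apply: (@is_derive_psum R N.+1 (fun m s => wcoef R [:: true] m * cos (m%:R * s + p))
     (fun m => wcoef R [:: true] m * (- sin (m%:R * t + p) * m%:R))) => m.
  exact: is_derive_scale _ (is_derive_comp (is_derive_cos _) (is_derive_affine _ _ _)).
rewrite big_ord_recl wcoef_cons0 mul0r add0r.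
rewrite -opprB -sum_sin_telescope mulNr mulrAC mulfV ?mul1r; last by rewrite gt_eqF // mulr_gt0.
rewrite -sumrN; apply: eq_bigr => i _; rewrite wcoef_one /=.
have : i.+1%:R != 0 :> R by rewrite pnatr_eq0.
by move=> ?; rewrite /bump /= add1n; field.
Qed.

Lemma is_derive_sin_half t :
  is_derive t (1 : R) (fun s => sin (s / 2)) (cos (t / 2) * 2^-1).
Proof.
apply: (@is_derive_comp R sin (fun s => s / 2)).
apply: (@is_derive_ext R (fun s => 2^-1 * s + 0)); last exact: is_derive_affine.
by move=> v; rewrite addr0 mulrC.
Qed.

(** The differentiated partial sums keep a term cos((N + 1/2) t + p) / (2 sin(t/2)) that does not
    converge. Its primitive to leading order, [r N], is O(1/N): subtracting it does not change the
    limit, and leaves derivatives that converge uniformly on ]t/2, pi[. *)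
Lemma Lphase_one_derive p t : 0 < t < pi ->
  is_derive t (1 : R) (Lphase p [:: true]) (- (cos (t / 2 + p) / (2 * sin (t / 2)))).
Proof.
move=> /andP[t0 tpi].
have t2 : 0 < t / 2 by rewrite divr_gt0.
have s0 : 0 < sin (t / 2 / 2) by apply: sin_half_gt0; lra.
set s1 := sin (t / 2 / 2) in s0.
pose c (N : nat) : R := N%:R + 2^-1.
have c0 N : 0 < c N by rewrite /c ltr_wpDl // ler0n.
have cV N : (c N)^-1 <= 2 * harmonic N.
  rewrite /harmonic /= -(invrK 2) -invfM lef_pV2 ?posrE ?mulr_gt0 ?invr_gt0 ?ltr0n //.
  rewrite /c -[N.+1%:R]natr1; have : 0 <= N%:R :> R by [].
  lra.
pose r N s := sin (c N * s + p) / (c N * (2 * sin (s / 2))).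
apply: (@termwise_derive R (fun N s => Lpart p [:: true] s N.+1 - r N s)
  (fun N s => (cos (N%:R * s + s / 2 + p) - cos (s / 2 + p)) / (2 * sin (s / 2))
     - (cos (c N * s + p) / (2 * sin (s / 2))
        - sin (c N * s + p) * cos (s / 2) / (4 * c N * sin (s / 2) ^+ 2)))
  _ (fun s => - (cos (s / 2 + p) / (2 * sin (s / 2))))
  (fun N => (2 * harmonic N) * (4 * s1 ^+ 2)^-1) (t / 2) pi).
- move=> N s /andP[ts spi].
  have spi' : 0 < s < pi by apply/andP; split; lra.
  have ss : 0 < sin (s / 2) := sin_half_gt0 spi'.
  apply: is_derive_sub; first exact: Lpart_one_derive.
  apply: is_derive_eq.
    have n0 : c N * (2 * sin (s / 2)) != 0 by rewrite gt_eqF // !mulr_gt0.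
    apply: (is_derive_mul
      (@is_derive_comp R sin (fun s => c N * s + p) s _ _ (is_derive_sin _)
        (is_derive_affine _ _ _))
      (@is_deriveV R (fun s => c N * (2 * sin (s / 2))) s _ 1 n0
        (is_derive_scale _ (is_derive_scale _ (is_derive_sin_half _))))).
  rewrite /GRing.scale /=; have := gt_eqF ss; have := gt_eqF (c0 N).
  by move=> h1 h2; field; rewrite h1 h2.
- move=> N s /andP[ts spi].
  have spi' : 0 < s < pi by apply/andP; split; lra.
  have ss : 0 < sin (s / 2) := sin_half_gt0 spi'.
  have -> : N%:R * s + s / 2 + p = c N * s + p by rewrite /c; field.
  have -> : (cos (c N * s + p) - cos (s / 2 + p)) / (2 * sin (s / 2))
     - (cos (c N * s + p) / (2 * sin (s / 2))
        - sin (c N * s + p) * cos (s / 2) / (4 * c N * sin (s / 2) ^+ 2))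
     - - (cos (s / 2 + p) / (2 * sin (s / 2)))
    = (sin (c N * s + p) * cos (s / 2)) * ((c N)^-1 * (4 * sin (s / 2) ^+ 2)^-1).
    have := gt_eqF ss; have := gt_eqF (c0 N).
    by move=> h1 h2; field; rewrite h1 h2.
  rewrite normrM; apply: le_trans (ler_piMl _ _) _ => //.
    rewrite normrM; apply: mulr_ile1 => //; last exact: cos_max.
    by rewrite ler_norml sin_geN1 sin_le1.
  rewrite ger0_norm; last by rewrite mulr_ge0 ?invr_ge0 ?ltW ?mulr_gt0 ?exprn_gt0.
  apply: ler_pM; [by rewrite invr_ge0 ltW
    |by rewrite invr_ge0 ltW // mulr_gt0 // exprn_gt0|exact: cV|].
  rewrite lef_pV2 ?posrE ?mulr_gt0 ?exprn_gt0 // ler_pM2l //.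
  apply: lerXn2r; [by rewrite nnegrE ltW|by rewrite nnegrE ltW|].
  by apply: sin_half_le => //; exact: ltW.
- rewrite -(mul0r (4 * s1 ^+ 2)^-1); apply: cvgM; last exact: cvg_cst.
  by rewrite -(mulr0 2); apply: cvgM; [exact: cvg_cst|exact: cvg_harmonic].
- move=> s /andP[ts spi].
  have spi' : 0 < s < pi by apply/andP; split; lra.
  have ss : 0 < sin (s / 2) := sin_half_gt0 spi'.
  rewrite -[X in _ --> X]subr0; apply: cvgB.
    by rewrite (cvg_shiftS (Lpart p [:: true] s)); exact: Lphase_cvg.
  have L2 : (2 * harmonic N) * (2 * sin (s / 2))^-1 @[N --> \oo] --> 0.
    rewrite -(mul0r (2 * sin (s / 2))^-1); apply: cvgM; last exact: cvg_cst.
    by rewrite -(mulr0 2); apply: cvgM; [exact: cvg_cst|exact: cvg_harmonic].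
  have L1 : - ((2 * harmonic N) * (2 * sin (s / 2))^-1) @[N --> \oo] --> 0.
    by rewrite -oppr0; exact: cvgN.
  apply: squeeze_cvgr L1 L2; apply: nearW => N; rewrite -ler_norml.
  rewrite /r normrM; apply: le_trans (ler_piMl _ _) _ => //.
    by rewrite ler_norml sin_geN1 sin_le1.
  rewrite ger0_norm; last by rewrite invr_ge0 ltW // !mulr_gt0.
  by rewrite invfM; apply: ler_wpM2r; [rewrite invr_ge0 ltW // mulr_gt0|exact: cV].
- by apply/andP; split; lra.
Qed.

(* The terms of even index of the series at [pi / 3] and [2 pi / 3] recombine
   into the series at [2 pi / 3]. *)
Lemma Lphase_one_duplication p (eps : R) :
  (forall s, cos (s - p) = eps * cos (s + p)) -> eps ^+ 2 = 1 ->
  Lphase p [:: true] (pi / 3) + eps * Lphase p [:: true] (2 * pi / 3)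
  = Lphase p [:: true] (2 * pi / 3).
Proof.
move=> epsP eps2.
have pi0 := pi_gt0 R.
have h1 : 0 < (pi / 3 : R) < pi by apply/andP; split; lra.
have h2 : 0 < (2 * pi / 3 : R) < pi by apply/andP; split; lra.
have dbl : (fun N => N.*2) N @[N --> \oo] --> \oo.
  move=> A [N _ NA]; exists N => // n /= Nn; apply: NA => /=.
  by apply: leq_trans Nn _; rewrite -addnn leq_addr.
have L t : 0 < t < pi -> Lpart p [:: true] t N.*2 @[N --> \oo] --> Lphase p [:: true] t.
  by move=> tpi; apply: (cvg_comp _ _ dbl); exact: Lphase_cvg.
have L1 : Lpart p [:: true] (pi / 3) N.*2 + eps * Lpart p [:: true] (2 * pi / 3) N.*2
    @[N --> \oo] --> Lphase p [:: true] (pi / 3) + eps * Lphase p [:: true] (2 * pi / 3).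
  by apply: cvgD; [exact: L|apply: cvgM; [exact: cvg_cst|exact: L]].
have L2 := Lphase_cvg (p := p) (w := [:: true]) h2.
apply: (cvg_unique _ L1) => //.
apply: cvg_trans L2; apply: near_eq_cvg; apply: nearW => N /=.
elim: N => [|N IH]; first by rewrite /Lpart !big_ord0 mulr0 addr0.
rewrite doubleS !LpartS IH !wcoef_one.
have refl (m : nat) : cos (m%:R * (2 * pi / 3) + p) = (-1) ^+ m * (eps * cos (m%:R * (pi / 3) + p)).
  have -> : m%:R * (2 * pi / 3) + p = - (m%:R * (pi / 3) - p) + m%:R * pi by field.
  rewrite -epsP -[cos (_ - p)]cosN.
  elim: (m) (- _ ) => [|k IHk] y; first by rewrite mul0r addr0 mul1r.
  rewrite -natr1 mulrDl mul1r addrA cosDpi IHk exprS; ring.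
have ev : (-1) ^+ N.*2 = 1 :> R by rewrite -mul2n exprM sqrrN expr1n expr1n.
have -> : cos (N%:R * (2 * pi / 3) + p) = cos (N.*2%:R * (pi / 3) + p).
  by congr cos; rewrite -mul2n natrM; field.
rewrite !refl exprS ev.
have dblV : N%:R^-1 = 2 * N.*2%:R^-1 :> R.
  by rewrite -mul2n natrM invfM mulrA divff ?mul1r.
rewrite dblV; set q := N.*2%:R^-1; set q' := N.*2.+1%:R^-1.
set u := cos _; set v := cos _.
transitivity (Lpart p [:: true] (pi / 3) N.*2 + eps * Lpart p [:: true] (2 * pi / 3) N.*2
   + q * u * (1 + eps ^+ 2) + q' * v * (1 - eps ^+ 2)); last by ring.
by rewrite eps2; ring.
Qed.

Lemma sin_pi6 : sin (pi / 3 / 2) = 2^-1 :> R.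
Proof.
have pi0 := pi_gt0 R.
have c0 : 0 < cos (pi / 3 / 2) :> R by apply: cos_gt0_pihalf; apply/andP; split; lra.
have E : sin (pi / 3) = cos (pi / 3 / 2) :> R.
  by rewrite -cosBpihalf -cosN; congr cos; field.
have cn0 : cos (pi / 3 / 2) != 0 :> R by rewrite gt_eqF.
apply: (mulfI cn0).
have -> : cos (pi / 3 / 2) * sin (pi / 3 / 2) = sin (pi / 3) / 2 :> R.
  have -> : pi / 3 = (pi / 3 / 2) *+ 2 :> R by rewrite mulr2n; field.
  rewrite sin_mulr2n.
  have -> : pi / 3 / 2 *+ 2 / 2 = pi / 3 / 2 :> R by rewrite mulr2n; field.
  by rewrite mulr2n; field.
by rewrite E.
Qed.

(** Equal derivatives, and both sides vanish at [pi / 3]: the left by duplication with [eps = 1],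
    the right because 2 sin(pi/6) = 1. *)
Lemma Lphase_one_re t : 0 < t < pi -> Lphase 0 [:: true] t = - Afun t.
Proof.
move=> tpi; have pi0 := pi_gt0 R.
have h1 : 0 < (pi / 3 : R) < pi by apply/andP; split; lra.
have Z : Lphase 0 [:: true] (pi / 3) = 0.
  have := @Lphase_one_duplication 0 1 _ (expr1n _ _).
  rewrite mul1r => H; apply: (addIr (Lphase 0 [:: true] (2 * pi / 3))).
  by rewrite add0r; apply: H => s; rewrite mul1r subr0 addr0.
have AE (u : R) : 0 < u < pi -> Afun u = ln (2 * sin (u / 2)).
  by move=> upi; rewrite /Afun ger0_norm // ltW // mulr_gt0 // sin_half_gt0.
have A0 : Afun (pi / 3) = 0 :> R.
  by rewrite AE // sin_pi6 divff // ln1.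
have D (u : R) : 0 < u < pi ->
   is_derive u (1 : R) (fun s => Lphase 0 [:: true] s + ln (2 * sin (s / 2))) 0.
  move=> upi; have ss := sin_half_gt0 upi.
  apply: is_derive_eq.
    apply: is_derive_add; first exact: Lphase_one_derive.
    have p0 : 0 < 2 * sin (u / 2) by rewrite mulr_gt0.
    apply: (@is_derive_comp R (@ln R) (fun s => 2 * sin (s / 2)) u _ _
      (is_derive1_ln p0) (is_derive_scale _ (is_derive_sin_half _))).
  by rewrite addr0; have := gt_eqF ss => h; field; rewrite h.
have := derive_zero_cst D h1 tpi.
by rewrite Z -!AE // A0 addr0 => /eqP; rewrite addr_eq0 => /eqP.
Qed.

(** The derivative gives C - t/2; duplication with [eps = -1] reads C - pi/6 = 2 (C - pi/3), so C =
    pi/2. *)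
Lemma Lphase_one_im t : 0 < t < pi ->
  Lphase (- (pi / 2)) [:: true] t = (pi - t) / 2.
Proof.
move=> tpi; have pi0 := pi_gt0 R.
have h1 : 0 < (pi / 3 : R) < pi by apply/andP; split; lra.
have h2 : 0 < (2 * pi / 3 : R) < pi by apply/andP; split; lra.
set L := Lphase _ _.
have Z : L (pi / 3) + -1 * L (2 * pi / 3) = L (2 * pi / 3).
  apply: Lphase_one_duplication; last by rewrite sqrrN expr1n.
  by move=> s; rewrite opprK cosDpihalf cosBpihalf mulN1r.
have D (u : R) : 0 < u < pi -> is_derive u (1 : R) (fun s => L s + (2^-1 * s + 0)) 0.
  move=> upi; have ss := sin_half_gt0 upi.
  apply: is_derive_eq (is_derive_add (Lphase_one_derive _ upi) (is_derive_affine _ _ _)) _.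
  by rewrite cosBpihalf; have := gt_eqF ss => h; field; rewrite h.
have := derive_zero_cst D h1 tpi; have := derive_zero_cst D h2 tpi.
move: Z; lra.
Qed.

End CirclePolylog.

(** * Integrability of powers of A near 0 *)

Section SingularIntegrals.
Variable R : realType.
Implicit Types (f g : R -> R) (s t : R).
Local Notation mu := (@lebesgue_measure R).

(** For [t > 0] this is t^(-1/2), integrable at 0 and, up to a constant, above every power of the
    logarithm there. *)
Definition isq t : R := expR (- (2^-1 * ln t)).

Lemma isq_primitive t : 0 < t ->
  is_derive t (1 : R) (fun s => 2 * expR (2^-1 * ln s)) (isq t).
Proof.
move=> t0.
apply: is_derive_eq.
  apply: (is_derive_scale 2 (@is_derive_comp R (@expR R) (fun s => 2^-1 * ln s) t _ _
    (is_derive_expR _) (is_derive_scale _ (is_derive1_ln t0)))).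
have -> : t^-1 = expR (- ln t) by rewrite expRN lnK // posrE.
set a := expR (_ * _); set b := expR (- _).
have -> : 2 * (a * (2^-1 * b)) = a * b by field.
by rewrite /a /b -expRD; congr expR; field.
Qed.

Lemma isq_continuous t : 0 < t -> {for t, continuous isq}.
Proof.
move=> t0.
apply: (is_derive_continuous (@is_derive_comp R (@expR R) (fun s => - (2^-1 * ln s)) t _ _
  (is_derive_expR _) (is_deriveN (is_derive_scale _ (is_derive1_ln t0))))).
Qed.

Lemma continuous_in_oo_measurable (a b : R) f :
  (forall t, a < t < b -> {for t, continuous f}) -> measurable_fun `]a, b[ f.
Proof.
move=> fc; apply: open_continuous_measurable_fun; first exact: interval_open.
by move=> t; rewrite inE /= in_itv /= => tab; exact: fc.
Qed.

(** On the intervals [1/(n+1), pi/2] the primitive 2 sqrt(t) bounds the integral by 2 sqrt(pi/2);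
    monotone convergence passes the bound to their union. *)
Lemma isq_integrable : mu.-integrable `]0, pi / 2[ (EFin \o isq).
Proof.
have pi0 : 0 < pi / 2 :> R by rewrite divr_gt0 // pi_gt0.
set b : R := pi / 2 in pi0 *.
have misq (a c : R) : 0 <= a -> measurable_fun `]a, c[ isq.
  move=> a0; apply: continuous_in_oo_measurable => t /andP[at_ _].
  by apply: isq_continuous; exact: le_lt_trans at_.
pose F (n : nat) : set R := `[n.+1%:R^-1, b]%classic.
have FU : \bigcup_n F n = `]0, b]%classic.
  apply/seteqP; split => [t [n _]|t].
    rewrite /F /= !in_itv /= => /andP[nt ->]; rewrite andbT.
    by apply: lt_le_trans nt; rewrite invr_gt0.
  rewrite /= in_itv /= => /andP[t0 tb].
  have [n _ /(_ n (leqnn n))] := cvgr_lt _ (@cvg_harmonic R) t t0.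
  by move=> /= /ltW nt; exists n => //; rewrite /F /= in_itv /= nt tb.
apply/integrableP; split; first by apply/measurable_EFinP; exact: misq.
have E t : `|(EFin \o isq) t|%E = (isq t)%:E by rewrite /= ger0_norm // /isq expR_ge0.
under eq_integral do rewrite E.
rewrite (@integral_itv_bndo_bndc R (BRight 0) b); last by apply/measurable_EFinP; exact: misq.
rewrite -FU.
have L : (\int[mu]_(x in F i) (isq x)%:E)%E @[i --> \oo] -->
    (\int[mu]_(x in \bigcup_i F i) (isq x)%:E)%E.
  apply: ge0_nondecreasing_set_cvg_integral.
  - move=> n m nm; apply/subsetPset => t; rewrite /F /= !in_itv /= => /andP[nt ->].
    rewrite andbT; apply: le_trans nt; rewrite lef_pV2 ?posrE //.
    by rewrite ler_nat.
  - by move=> n; exact: measurable_itv.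
  - move=> n; apply/measurable_EFinP; apply: measurable_fun_itv_cc.
    by apply: (misq n.+1%:R^-1 b); rewrite invr_ge0.
  - by move=> n t _; rewrite lee_fin expR_ge0.
apply: (@le_lt_trans _ _ (2 * expR (2^-1 * ln b))%:E); last exact: ltry.
rewrite -(cvg_lim _ L) //; apply: lime_le; first by apply/cvg_ex; eexists; exact: L.
have H : \forall n \near \oo, harmonic n < b by exact: (cvgr_lt _ (@cvg_harmonic R)).
apply: filterS H => n /= nb.
have n0 : 0 < n.+1%:R^-1 :> R by rewrite invr_gt0.
rewrite (@continuous_FTC2 R isq (fun s => 2 * expR (2^-1 * ln s)) _ _ nb).
- by rewrite -EFinB lee_fin gerBl mulr_ge0 // expR_ge0.
- apply: continuous_in_subspaceT => t; rewrite inE /= in_itv /= => /andP[nt _].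
  by apply: isq_continuous; exact: lt_le_trans nt.
- split.
  + move=> t; rewrite in_itv /= => /andP[nt _].
    by have [] := isq_primitive (lt_trans n0 nt).
  + by apply: cvg_at_right_filter; exact: is_derive_continuous (isq_primitive n0).
  + by apply: cvg_at_left_filter; exact: is_derive_continuous (isq_primitive pi0).
- move=> t; rewrite in_itv /= => /andP[nt _]; rewrite derive1E.
  by have [_ ->] := isq_primitive (lt_trans n0 nt).
Qed.

(** A class made for induction on iterated integrals: its primitives are bounded and continuous, and
    it is stable under multiplication by such functions. *)
Definition singular f : Prop :=
  (forall t, 0 < t < pi / 2 -> {for t, continuous f}) /\
  exists C : R, forall t, 0 < t < pi / 2 -> `|f t| <= C * isq t.

Lemma singularM f g (K : R) : singular f ->
  (forall t, 0 < t < pi / 2 -> {for t, continuous g}) ->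
  (forall t, 0 < t < pi / 2 -> `|g t| <= K) ->
  singular (fun t => f t * g t).
Proof.
move=> [fc [C fC]] gc gK; split.
  by move=> t tp; apply: cvgM; [exact: fc|exact: gc].
exists (C * K) => t tp; rewrite normrM mulrAC; apply: ler_pM => //; [exact: fC|exact: gK].
Qed.

Lemma singular_integrable f : singular f ->
  mu.-integrable `]0, pi / 2[ (EFin \o f).
Proof.
move=> [fc [C fC]].
apply: (@le_integrable _ _ _ mu _ _ _ (fun t => (C%:E * (EFin \o isq) t)%E)).
- exact: measurable_itv.
- by apply/measurable_EFinP; exact: continuous_in_oo_measurable.
- move=> t; rewrite /= in_itv /= => tp; rewrite lee_fin.
  by apply: le_trans (fC t tp) (ler_norm _).
- by apply: integrableZl; [exact: measurable_itv|exact: isq_integrable].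
Qed.

(** [singular] says nothing about the value at 0, but endpoints are negligible. *)
Lemma singular_integrable_cc f t : singular f -> t < pi / 2 ->
  mu.-integrable `[0, t] (EFin \o f).
Proof.
move=> sf tp; have /integrableP[mf If] : mu.-integrable `]0, t[ (EFin \o f).
  apply: integrableS (singular_integrable sf); try exact: measurable_itv.
  by move=> s /=; rewrite !in_itv /= => /andP[-> st] /=; exact: lt_trans tp.
apply/integrableP; split; first exact: emeasurable_fun_itv_cc mf.
by rewrite integral_itv_bndoo //; exact: (measurableT_comp (@abse_measurable R setT) mf).
Qed.

Lemma singular_primitive f : singular f ->
  let F t := \int[mu]_(s in `[0, t]) f s in
  [/\ forall t, 0 < t < pi / 2 -> is_derive t (1 : R) F (f t),
      F t @[t --> 0^'+] --> 0 &
      exists K : R, forall t, 0 < t < pi / 2 -> `|F t| <= K].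
Proof.
move=> sf F; have pi0 : 0 < pi / 2 :> R by rewrite divr_gt0 // pi_gt0.
have pi4 : 0 < pi / 2 / 2 :> R by rewrite divr_gt0.
split.
- move=> t /andP[t0 tp].
  pose u := (t + pi / 2) / 2; have tu : t < u by rewrite /u; lra.
  have up : u < pi / 2 by rewrite /u; lra.
  have tc : {for t, continuous f} by apply: (proj1 sf); rewrite t0.
  have [D1 D2] := continuous_FTC1_closed tu (singular_integrable_cc sf up) t0 tc.
  by apply: DeriveDef => //; rewrite -derive1E.
- apply: cvg_at_right_filter.
  apply: (parameterized_integral_cvg_left pi4); apply: singular_integrable_cc => //; lra.
- have /integrableP[mf If] := singular_integrable sf.
  exists (fine (\int[mu]_(x in `]0%R, (pi / 2)%R[) `|(EFin \o f) x|)%E) => t /andP[t0 tp].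
  have ift := singular_integrable_cc sf tp.
  have FF : `|F t| <= \int[mu]_(s in `[0, t]) `|f s|.
    by apply: le_normr_Rintegral => //; exact: measurable_itv.
  apply: le_trans FF _.
  have /integrableP[mft Ift] := ift.
  rewrite /Rintegral; apply: fine_le.
  + by apply: integrable_fin_num; [exact: measurable_itv|exact: integrable_norm ift].
  + rewrite ge0_fin_numE //; apply: integral_ge0 => *; exact: abse_ge0.
  have mt : measurable_fun `]0, t[ (EFin \o f).
    by apply: measurable_funS mft; [exact: measurable_itv|exact: subset_itvW].
  rewrite (@integral_itv_bndoo R 0 t (fun s => `|f s|%:E) true false); last first.
    exact: (measurableT_comp (@abse_measurable R setT) mt).
  apply: ge0_subset_integral.
  + exact: measurable_itv.
  + exact: measurable_itv.
  + exact: (measurableT_comp (@abse_measurable R setT) mf).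
  + by move=> s _; rewrite lee_fin normr_ge0.
  + by move=> s /=; rewrite !in_itv /= => /andP[-> st] /=; exact: lt_trans tp.
Qed.

(** Mean value theorem for the sine, whose derivative is at least 1/2 on [0, pi/3]. *)
Lemma half_sin_ge t : 0 < t < pi / 2 -> t / 2 <= 2 * sin (t / 2).
Proof.
move=> /andP[t0 tp]; have pi0 := pi_gt0 R.
have t20 : 0 < t / 2 by rewrite divr_gt0.
have sc : {within `[0, t / 2], continuous (@sin R)}.
  by apply: continuous_subspaceT => s; exact: continuous_sin.
have [c] := MVT t20 (fun s _ => is_derive_sin s) sc.
rewrite in_itv /= => /andP[c0 ct]; rewrite sin0 !subr0 => ->.
have cc : 2^-1 <= cos c.
  have -> : 2^-1 = cos (pi / 3) :> R.
    rewrite -sin_pi6 -cosBpihalf -[cos (_ - _)]cosN; congr cos; by field.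
  apply/ltW; rewrite ltr_cos ?in_itv /=; first by lra.
    by apply/andP; split; lra.
  by apply/andP; split; lra.
have : 2^-1 * (t / 2) <= cos c * (t / 2) by apply: ler_wpM2r => //; exact: ltW.
lra.
Qed.

Lemma Afun_bound t : 0 < t < pi / 2 -> `|Afun t| <= ln 2 + ln 2 - ln t.
Proof.
move=> /[dup] /half_sin_ge hs /andP[t0 tp]; have pi0 := pi_gt0 R.
have t20 : 0 < t / 2 by rewrite divr_gt0.
have s0 : 0 < 2 * sin (t / 2) := lt_le_trans t20 hs.
have pi4 : pi / 2 <= 2 :> R by apply: ltW; exact: pihalf_lt2.
have t2 : ln t <= ln 2 by rewrite ler_ln ?posrE //; lra.
rewrite /Afun (ger0_norm (ltW s0)).
have U : ln (2 * sin (t / 2)) <= ln 2.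
  by rewrite ler_ln ?posrE //; have := sin_le1 (t / 2); lra.
have L : ln t - ln 2 <= ln (2 * sin (t / 2)).
  by rewrite -ln_div ?posrE // ler_ln ?posrE.
have l2 : 0 <= ln 2 :> R by apply: ln_ge0; lra.
rewrite ler_norml; apply/andP; split; lra.
Qed.

Lemma Afun_continuous t : 0 < t < pi / 2 -> {for t, continuous (@Afun R)}.
Proof.
move=> /[dup] /half_sin_ge hs /andP[t0 tp].
have s0 : 0 < 2 * sin (t / 2) by apply: lt_le_trans hs; rewrite divr_gt0.
have c1 : {for t, continuous (fun s => 2 * sin (s / 2))}.
  exact: is_derive_continuous (is_derive_scale 2 (is_derive_sin_half t)).
have c2 : {for t, continuous (fun s => `|2 * sin (s / 2)|)} by apply: cvg_norm; exact: c1.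
apply: (@continuous_comp _ _ _ (fun s => `|2 * sin (s / 2)|) (@ln R)) => //.
by apply: continuous_ln; rewrite normr_gt0 gt_eqF.
Qed.

Lemma continuous_pow f (n : nat) t : {for t, continuous f} ->
  {for t, continuous (fun s => f s ^+ n)}.
Proof.
move=> fc; elim: n => [|n IH]; first exact: cvg_cst.
have -> : (fun s => f s ^+ n.+1) = (fun s => f s * f s ^+ n).
  by apply/funext => s; rewrite exprS.
exact: cvgM.
Qed.

(** With y = 2 ln 2 - ln t one has y^j <= 2^j j! e^(y/2) by the exponential series, and e^(y/2) is 2
    t^(-1/2). *)
Lemma Afun_pow_singular (j : nat) : singular (fun t => Afun t ^+ j).
Proof.
split.
  by move=> t tp; apply: continuous_pow; exact: Afun_continuous.
exists (2 ^+ j * j`!%:R * 2) => t tp.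
rewrite normrX.
set y := ln 2 + ln 2 - ln t; have Ay : `|Afun t| <= y := Afun_bound tp.
have y0 : 0 <= y by apply: le_trans Ay.
have -> : isq t = expR (y / 2) / 2.
  have e2 : 2 = expR (ln 2) :> R by rewrite lnK // posrE.
  by rewrite [X in _ / X]e2 -expRN -expRD /isq; congr expR; rewrite /y; field.
set E := expR _.
have -> : 2 ^+ j * j`!%:R * 2 * (E / 2) = 2 ^+ j * (j`!%:R * E) by field.
apply: le_trans (lerXn2r _ _ _ Ay) _; rewrite ?nnegrE //.
have -> : y ^+ j = 2 ^+ j * (y / 2) ^+ j by rewrite -exprMn; congr (_ ^+ _); field.
apply: ler_wpM2l; first exact: exprn_ge0.
have y20 : 0 <= y / 2 by rewrite divr_ge0.
case: j => [|j]; first by rewrite expr0 mul1r; apply: le_trans (expR_ge1Dx _); rewrite lerDl.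
rewrite -ler_pdivrMl ?ltr0n ?fact_gt0 // mulrC.
by apply: le_trans (expR_ge1Dxn j y20); rewrite lerDr.
Qed.

Lemma affine_pow_continuous (c : R) (l : nat) t :
  {for t, continuous (fun s => (s - c) ^+ l)}.
Proof.
by apply: continuous_pow; apply: cvgB; [exact: cvg_id|exact: cvg_cst].
Qed.

(** Serves both the log-sine integrands ([c = 0]) and the SLs integrands ([c = pi / 3]). *)
Lemma singular_log_sine (c : R) (l j : nat) :
  singular (fun t => (t - c) ^+ l * Afun t ^+ j).
Proof.
have -> : (fun t => (t - c) ^+ l * Afun t ^+ j)
  = (fun t => Afun t ^+ j * (t - c) ^+ l) by apply/funext => t; rewrite mulrC.
apply: (@singularM _ _ ((pi / 2 + `|c|) ^+ l)); first exact: Afun_pow_singular.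
  by move=> t _; exact: affine_pow_continuous.
move=> t /andP[t0 tp]; rewrite normrX; apply: lerXn2r; rewrite ?nnegrE //.
  by rewrite addr_ge0 // divr_ge0 // pi_ge0.
by apply: le_trans (ler_normB _ _) _; rewrite lerD2r ger0_norm ltW.
Qed.

End SingularIntegrals.

(** * Iterated integrals of singular functions and their shuffle product *)

Section IteratedIntegrals.
Variables (R : realType) (I : eqType) (phi : I -> R -> R).
Hypothesis phi_singular : forall i, singular (phi i).

Definition iterI (js : seq I) (t : R) : R := iter_int_rev [seq phi i | i <- js] t.

Lemma iterI_bounded_continuous js :
  (forall t, 0 < t < pi / 2 -> {for t, continuous (iterI js)}) /\
  exists K : R, forall t, 0 < t < pi / 2 -> `|iterI js t| <= K.
Proof.
elim: js => [|i js [IHc [K IHK]]].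
  by split; [move=> t _; exact: cvg_cst|exists 1 => t _; rewrite /iterI /= normr1].
have [D _ B] := singular_primitive (singularM (phi_singular i) IHc IHK).
split; last exact: B.
by move=> t tp; exact: is_derive_continuous (D t tp).
Qed.

Lemma iterI_singular i js : singular (fun t => phi i t * iterI js t).
Proof.
have [c [K B]] := iterI_bounded_continuous js.
exact: singularM (phi_singular i) c B.
Qed.

Lemma iterI_derive i js t : 0 < t < pi / 2 ->
  is_derive t (1 : R) (iterI (i :: js)) (phi i t * iterI js t).
Proof. by have [D _ _] := singular_primitive (iterI_singular i js); exact: D. Qed.

Lemma iterI_at0 i js : iterI (i :: js) t @[t --> 0^'+] --> 0.
Proof. by have [_ D _] := singular_primitive (iterI_singular i js). Qed.

Lemma derive_unique (f g : R -> R) (d : R -> R) :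
  (forall t, 0 < t < pi / 2 -> is_derive t (1 : R) f (d t)) ->
  (forall t, 0 < t < pi / 2 -> is_derive t (1 : R) g (d t)) ->
  f t @[t --> 0^'+] --> 0 -> g t @[t --> 0^'+] --> 0 ->
  forall t, 0 < t < pi / 2 -> f t = g t.
Proof.
move=> fd gd f0 g0 t tp; apply/eqP; rewrite -subr_eq0; apply/eqP.
apply: (@derive_zero_eq0 R (fun s => f s - g s) (pi / 2)) tp.
- move=> s sp; rewrite -(subrr (d s)).
  by apply: is_derive_sub; [exact: fd|exact: gd].
- by rewrite -[X in _ --> X](subrr 0); exact: cvgB.
Qed.

Lemma is_derive_bigsum (J : Type) (L : seq J) (h : J -> R -> R) (dh : J -> R) (t : R) :
  (forall l, is_derive t (1 : R) (h l) (dh l)) ->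
  is_derive t (1 : R) (fun s => \sum_(l <- L) h l s) (\sum_(l <- L) dh l).
Proof.
move=> hd; elim: L => [|l L IH].
  rewrite big_nil; apply: is_derive_ext (is_derive_cst 0 t 1) => s.
  by rewrite big_nil.
rewrite big_cons; apply: is_derive_ext (is_derive_add (hd l) IH) => s.
by rewrite big_cons.
Qed.

Lemma cvg_bigsum_at0 (J : Type) (L : seq J) (h : J -> R -> R) :
  (forall l, h l t @[t --> 0^'+] --> 0) ->
  \sum_(l <- L) h l t @[t --> 0^'+] --> 0.
Proof.
move=> h0; elim: L => [|l L IH].
  under eq_fun do rewrite big_nil; exact: cvg_cst.
rewrite -[X in _ --> X](addr0 0); under eq_fun do rewrite big_cons; exact: cvgD.
Qed.

(** By the product rule both sides have the same derivative, which strips the outermost integrand of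
    one factor, and both tend to 0 at 0+. Knowing the lists up to permutation is enough to read off
    weight and depth. *)
Lemma iterI_shuffle js1 js2 : exists L : seq (seq I),
  (forall l, l \in L -> perm_eq l (js1 ++ js2)) /\
  forall t, 0 < t < pi / 2 ->
    iterI js1 t * iterI js2 t = \sum_(l <- L) iterI l t.
Proof.
have [n] := ubnP (size js1 + size js2)%N.
elim: n => // n IH in js1 js2 *; rewrite ltnS => sn.
case: js1 sn => [|a js1] sn.
  by exists [:: js2]; split=> [l|t _]; [rewrite inE => /eqP ->|rewrite big_seq1 mul1r].
case: js2 sn => [|b js2] sn.
  exists [:: a :: js1]; split=> [l|t _]; first by rewrite inE cats0 => /eqP ->.
  by rewrite big_seq1 mulr1.
have [|L1 [P1 E1]] := IH js1 (b :: js2); first by [].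
have [|L2 [P2 E2]] := IH (a :: js1) js2; first by rewrite addnS in sn.
exists ([seq a :: l | l <- L1] ++ [seq b :: l | l <- L2]); split.
  move=> l; rewrite mem_cat => /orP[] /mapP[l' l'L ->].
    by rewrite /= perm_cons P1.
  rewrite (perm_trans (y := b :: ((a :: js1) ++ js2))) ?perm_cons ?P2 //.
  by rewrite -[b :: js2]cat1s -[b :: (_ ++ _)]cat1s perm_catCA.
pose d t := phi a t * (iterI js1 t * iterI (b :: js2) t)
  + phi b t * (iterI (a :: js1) t * iterI js2 t).
apply: (@derive_unique _ _ d).
- move=> t tp; rewrite /d.
  apply: is_derive_eq (is_derive_mul (iterI_derive a js1 tp) (iterI_derive b js2 tp)) _.
  by ring.
- move=> t tp.
  (* The empty list does not occur in this sum; the default branch only makes the summand total. *)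
  have -> : d t = \sum_(l <- [seq a :: l | l <- L1] ++ [seq b :: l | l <- L2])
      (if l is i :: l' then phi i t * iterI l' t else 0).
    by rewrite /d E1 // E2 // big_cat !big_map !mulr_sumr.
  apply: is_derive_bigsum => -[|i l]; last exact: iterI_derive.
  exact: is_derive_cst.
- by rewrite -[X in _ --> X](mulr0 0); apply: cvgM; exact: iterI_at0.
- rewrite -[X in _ --> X](addr0 0); under eq_fun do rewrite big_cat !big_map.
  by apply: cvgD; apply: cvg_bigsum_at0 => l; exact: iterI_at0.
Qed.

End IteratedIntegrals.

(** * Rational spans and their products *)

Section RationalSpans.
Variable R : realType.
Implicit Types (P Q S : R -> Prop) (x y : R).

Lemma inspanQ_gen P x : P x -> inspanQ P x.
Proof.
move=> Px; exists [:: (1, x)]; split=> [p|]; first by rewrite inE => /eqP ->.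
by rewrite big_seq1 rmorph1 mul1r.
Qed.

Lemma inspanQ0 P : inspanQ P 0.
Proof. by exists [::]; split => //; rewrite big_nil. Qed.

Lemma inspanQD P x y : inspanQ P x -> inspanQ P y -> inspanQ P (x + y).
Proof.
move=> [s [sP ->]] [s' [sP' ->]]; exists (s ++ s'); split; last by rewrite big_cat.
by move=> p; rewrite mem_cat => /orP[/sP|/sP'].
Qed.

Lemma inspanQZ P (q : rat) x : inspanQ P x -> inspanQ P (ratr q * x).
Proof.
move=> [s [sP ->]]; exists [seq (q * p.1, p.2) | p <- s]; split.
  by move=> _ /mapP[p ps ->] /=; exact: (sP p).
rewrite big_map mulr_sumr; apply: eq_bigr => p _ /=.
by rewrite rmorphM mulrA.
Qed.

Lemma inspanQN P x : inspanQ P x -> inspanQ P (- x).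
Proof. by move=> /(inspanQZ (-1)); rewrite rmorphN1 mulN1r. Qed.

Lemma inspanQ_sum P (I : eqType) (r : seq I) (F : I -> R) :
  (forall i, i \in r -> inspanQ P (F i)) -> inspanQ P (\sum_(i <- r) F i).
Proof.
elim: r => [|i r IH] H; first by rewrite big_nil; exact: inspanQ0.
rewrite big_cons; apply: inspanQD; first by apply: H; rewrite mem_head.
by apply: IH => j jr; apply: H; rewrite inE jr orbT.
Qed.

Lemma inspanQ_sub P Q x :
  (forall y, P y -> inspanQ Q y) -> inspanQ P x -> inspanQ Q x.
Proof.
move=> PQ [s [sP ->]]; apply: inspanQ_sum => p ps.
by apply: inspanQZ; apply: PQ; exact: sP.
Qed.

Lemma inspanQM P Q S x y :
  (forall u v, P u -> Q v -> inspanQ S (u * v)) ->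
  inspanQ P x -> inspanQ Q y -> inspanQ S (x * y).
Proof.
move=> PQS [s [sP ->]] [s' [sP' ->]]; rewrite mulr_suml.
apply: inspanQ_sum => p ps; rewrite mulr_sumr; apply: inspanQ_sum => p' ps'.
rewrite mulrACA -rmorphM; apply: inspanQZ.
by apply: PQS; [exact: sP|exact: sP'].
Qed.

End RationalSpans.

(** * Graded products of values SLs *)

Section SLsAlgebra.
Variable R : realType.

(* [Sset false] and [Sset true] are the sets S^e and S^o. *)
Definition Sset (p : bool) (k d : nat) (x : R) : Prop :=
  exists (m : nat) (js : seq nat),
    [/\ x = pi ^+ m * SLs R js, (m + sumn js)%N = k,
        (size js <= d)%N, odd (size js) = p & all (fun j => (2 <= j)%N) js].

Lemma So_Sset k d x : So_set k d x -> Sset true k d x.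
Proof. by move=> [m [js [? ? ? ? ?]]]; exists m, js; split. Qed.

Lemma Se_Sset k d x : Se_set k d x -> Sset false k d x.
Proof. by move=> [m [js [? ? ? /negbTE ? ?]]]; exists m, js; split. Qed.

Lemma Sset_So k d x : Sset true k d x -> So_set k d x.
Proof. by move=> [m [js [? ? ? ? ?]]]; exists m, js; split. Qed.

Lemma Sset_Se k d x : Sset false k d x -> Se_set k d x.
Proof. by move=> [m [js [? ? ? /negbT ? ?]]]; exists m, js; split. Qed.

(* All entries being odd, the depth has the parity of the weight. *)
Lemma S'_Sset k d x : S'_set k d x -> Sset (odd k) k d x.
Proof.
move=> [m [js [-> <- sd js3]]]; exists (2 * m)%N, js; split => //.
  rewrite oddD mul2n odd_double /=; elim: js js3 {sd} => //= j js IH.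
  by move=> /andP[/andP[oj _] /IH ->]; rewrite oddD oj.
by apply: sub_all js3 => j /andP[_] /ltnW.
Qed.

Definition slphi (k : nat) (t : R) : R := (t - pi / 3) ^+ (k - 2)%N * Afun t.

Lemma slphi_singular k : singular (slphi k).
Proof. exact: (singular_log_sine (pi / 3) (k - 2) 1). Qed.

Lemma SLs_iterI js : SLs R js = iterI slphi (rev js) (pi / 3).
Proof. by rewrite /SLs /iter_int /iterI map_rev. Qed.

Lemma pi3_itv : 0 < (pi / 3 : R) < pi / 2.
Proof. have := pi_gt0 R; move=> ?; apply/andP; split; lra. Qed.

Lemma Sset_mono p k d d' x : (d <= d')%N -> Sset p k d x -> Sset p k d' x.
Proof.
move=> dd [m [js [-> kE sd ps jsP]]]; exists m, js; split => //.
exact: leq_trans dd.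
Qed.

(** Each term of the shuffle product at [pi / 3] permutes the concatenated indices, so weights and
    depths add, and parities add modulo 2. *)
Lemma SsetM p p' k k' d d' x y : Sset p k d x -> Sset p' k' d' y ->
  inspanQ (Sset (p (+) p') (k + k') (d + d')) (x * y).
Proof.
move=> [m [js [-> <- sd <- jsP]]] [m' [js' [-> <- sd' <- jsP']]].
rewrite mulrACA -exprD !SLs_iterI.
have [L [LP LE]] := iterI_shuffle slphi_singular (rev js) (rev js').
rewrite LE; last exact: pi3_itv.
rewrite mulr_sumr; apply: inspanQ_sum => l /LP lP; apply: inspanQ_gen.
have lP' : perm_eq (rev l) (js ++ js').
  rewrite perm_rev; apply: perm_trans lP _; rewrite -rev_cat perm_rev.
  by rewrite perm_catC.
exists (m + m')%N, (rev l); split.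
- by rewrite SLs_iterI revK.
- by rewrite (perm_sumn lP') sumn_cat addnACA.
- by rewrite (perm_size lP') size_cat leq_add.
- by rewrite (perm_size lP') size_cat oddD.
- by rewrite (perm_all _ lP') all_cat jsP.
Qed.

End SLsAlgebra.

(** * Complex values: the parity grading, derivatives and limits along the circle *)

Section ComplexValues.
Variable R : realType.
Local Open Scope complex_scope.
Implicit Types (z : R[i]) (f g : R -> R[i]).

Local Notation ReC := complex.Re.
Local Notation ImC := complex.Im.

Lemma complex_eqP z z' : ReC z = ReC z' -> ImC z = ImC z' -> z = z'.
Proof. by case: z z' => [a b] [c d] /= -> ->. Qed.

Lemma ratrC_nat (n : nat) : (ratr n%:R)%:C = n%:R :> R[i].
Proof. by rewrite ratr_nat rmorph_nat. Qed.

Lemma ratrC_opp (q : rat) : (ratr (- q))%:C = - (ratr q)%:C :> R[i].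
Proof. by rewrite !rmorphN. Qed.

Lemma ratrC_inv (q : rat) : (ratr q^-1)%:C = ((ratr q)%:C)^-1 :> R[i].
Proof. by rewrite !fmorphV. Qed.

Lemma ReCD z z' : ReC (z + z') = ReC z + ReC z'.
Proof. by case: z z' => [a b] [c d]. Qed.

Lemma ImCD z z' : ImC (z + z') = ImC z + ImC z'.
Proof. by case: z z' => [a b] [c d]. Qed.

Lemma ReCM z z' : ReC (z * z') = ReC z * ReC z' - ImC z * ImC z'.
Proof. by case: z z' => [a b] [c d]. Qed.

Lemma ImCM z z' : ImC (z * z') = ReC z * ImC z' + ImC z * ReC z'.
Proof. by case: z z' => [a b] [c d]. Qed.

(* Elements homogeneous of weight [w]: real parts are spanned by products of
   depth parity [odd w], imaginary parts by the opposite parity.  This grading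
   is multiplicative and contains [i pi], multiple zeta values and polylogarithms
   at [e^(i pi / 3)]. *)
Definition homog (w d : nat) z : Prop :=
  inspanQ (@Sset R (odd w) w d) (ReC z) /\ inspanQ (@Sset R (~~ odd w) w d) (ImC z).

Lemma homog0 w d : homog w d 0.
Proof. by split; exact: inspanQ0. Qed.

Lemma homogD w d z z' : homog w d z -> homog w d z' -> homog w d (z + z').
Proof. by move=> [? ?] [? ?]; split; rewrite ?ReCD ?ImCD; exact: inspanQD. Qed.

Lemma homogZ w d (q : rat) z : homog w d z -> homog w d ((ratr q)%:C * z).
Proof.
move=> [h1 h2]; split; rewrite ?ReCM ?ImCM /= mul0r ?subr0 ?addr0; exact: inspanQZ.
Qed.

Lemma homog_mono w d d' z : (d <= d')%N -> homog w d z -> homog w d' z.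
Proof.
move=> dd [h1 h2]; split.
  by apply: inspanQ_sub h1 => y Sy; apply: inspanQ_gen; exact: Sset_mono Sy.
by apply: inspanQ_sub h2 => y Sy; apply: inspanQ_gen; exact: Sset_mono Sy.
Qed.

Lemma homogM w w' d d' z z' : homog w d z -> homog w' d' z' ->
  homog (w + w') (d + d') (z * z').
Proof.
move=> [h1 h2] [h1' h2']; have M p p' x y : inspanQ (@Sset R p w d) x ->
    inspanQ (@Sset R p' w' d') y ->
    inspanQ (@Sset R (p (+) p') (w + w') (d + d')) (x * y).
  by apply: inspanQM => u v; exact: SsetM.
split; rewrite ?ReCM ?ImCM oddD; apply: inspanQD.
- exact: M.
- have -> : odd w (+) odd w' = ~~ odd w (+) ~~ odd w' by case: (odd w); case: (odd w').
  by apply: inspanQN; exact: M.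
- have -> : ~~ (odd w (+) odd w') = odd w (+) ~~ odd w' by case: (odd w).
  exact: M.
- have -> : ~~ (odd w (+) odd w') = ~~ odd w (+) odd w' by case: (odd w); case: (odd w').
  exact: M.
Qed.

Lemma homog1 : homog 0 0 1.
Proof.
split; last exact: inspanQ0.
apply: inspanQ_gen; exists 0%N, [::]; split => //.
by rewrite expr0 mul1r.
Qed.

Lemma homog_ipi : homog 1 0 ('i%C * pi%:C).
Proof.
split; rewrite ?ReCM ?ImCM /=.
  by rewrite mul0r mul1r subrr; exact: inspanQ0.
rewrite mul0r mul1r add0r; apply: inspanQ_gen; exists 1%N, [::]; split => //.
by rewrite expr1 mulr1.
Qed.

Lemma homogX w z n : homog w 0 z -> homog (n * w) 0 (z ^+ n).
Proof.
move=> h; elim: n => [|n IH]; first exact: homog1.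
by rewrite exprS mulSn -[0%N]addn0; exact: homogM.
Qed.

Definition cderive f (t : R) z : Prop :=
  is_derive t (1 : R) (fun s => ReC (f s)) (ReC z) /\
  is_derive t (1 : R) (fun s => ImC (f s)) (ImC z).

Lemma cderiveD f g t z z' : cderive f t z -> cderive g t z' ->
  cderive (fun s => f s + g s) t (z + z').
Proof.
move=> [a b] [c d]; split.
  by rewrite ReCD; apply: is_derive_ext (is_derive_add a c) => s; rewrite ReCD.
by rewrite ImCD; apply: is_derive_ext (is_derive_add b d) => s; rewrite ImCD.
Qed.

Lemma cderiveM f g t z z' : cderive f t z -> cderive g t z' ->
  cderive (fun s => f s * g s) t (f t * z' + z * g t).
Proof.
move=> [a b] [c d]; split.
  apply: (@is_derive_ext R (fun s => ReC (f s) * ReC (g s) - ImC (f s) * ImC (g s))).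
    by move=> s; rewrite ReCM.
  apply: is_derive_eq (is_derive_sub (is_derive_mul a c) (is_derive_mul b d)) _.
  by rewrite ReCD !ReCM; ring.
apply: (@is_derive_ext R (fun s => ReC (f s) * ImC (g s) + ImC (f s) * ReC (g s))).
  by move=> s; rewrite ImCM.
apply: is_derive_eq (is_derive_add (is_derive_mul a d) (is_derive_mul b c)) _.
by rewrite ImCD !ImCM; ring.
Qed.

Lemma cderive_cst z t : cderive (fun=> z) t 0.
Proof. by split; exact: is_derive_cst. Qed.

Lemma cderiveZ f t c z : cderive f t z -> cderive (fun s => c * f s) t (c * z).
Proof.
by move=> /(cderiveM (cderive_cst c t)); rewrite mul0r addr0.
Qed.

Definition it (t : R) : R[i] := 'i%C * t%:C.

Lemma cderive_it t : cderive it t 'i%C.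
Proof.
rewrite /cderive /=; split.
  apply: (@is_derive_ext R (fun=> 0)) => s.
  by rewrite mul0r mulr0 subr0.
apply: (@is_derive_ext R id) => s.
by rewrite mul0r mul1r add0r.
Qed.

Lemma cderive_itX n t :
  cderive (fun s => it s ^+ n.+1) t (n.+1%:R * 'i%C * it t ^+ n).
Proof.
elim: n => [|n IH]; first by rewrite mul1r mulr1; exact: cderive_it.
have -> : (fun s => it s ^+ n.+2) = (fun s => it s * it s ^+ n.+1).
  by apply/funext => s; rewrite exprS.
have -> : n.+2%:R * 'i%C * it t ^+ n.+1
  = it t * (n.+1%:R * 'i%C * it t ^+ n) + 'i%C * it t ^+ n.+1 :> R[i].
  by rewrite -[n.+2%:R]natr1 [it t ^+ n.+1]exprS; ring.
exact: cderiveM (cderive_it t) IH.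
Qed.

Definition ccvg0 f z : Prop :=
  ReC (f t) @[t --> 0^'+] --> ReC z /\ ImC (f t) @[t --> 0^'+] --> ImC z.

Lemma ccvg0D f g z z' : ccvg0 f z -> ccvg0 g z' ->
  ccvg0 (fun t => f t + g t) (z + z').
Proof.
move=> [a b] [c d]; split.
  by rewrite ReCD; under eq_fun do rewrite ReCD; exact: cvgD.
by rewrite ImCD; under eq_fun do rewrite ImCD; exact: cvgD.
Qed.

Lemma ccvg0M f g z z' : ccvg0 f z -> ccvg0 g z' ->
  ccvg0 (fun t => f t * g t) (z * z').
Proof.
move=> [a b] [c d]; split.
  by rewrite ReCM; under eq_fun do rewrite ReCM; apply: cvgB; exact: cvgM.
by rewrite ImCM; under eq_fun do rewrite ImCM; apply: cvgD; exact: cvgM.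
Qed.

Lemma ccvg0_cst z : ccvg0 (fun=> z) z.
Proof. by split; exact: cvg_cst. Qed.

Lemma ccvg0_it : ccvg0 it 0.
Proof.
split.
  under eq_fun do rewrite ReCM /= mul0r mulr0 subr0; exact: cvg_cst.
under eq_fun do rewrite ImCM /= mul0r mul1r add0r.
by apply: cvg_at_right_filter; exact: cvg_id.
Qed.

Lemma ccvg0_itX n : ccvg0 (fun t => it t ^+ n.+1) 0.
Proof.
elim: n => [|n IH]; first exact: ccvg0_it.
have -> : (fun s => it s ^+ n.+2) = (fun s => it s * it s ^+ n.+1).
  by apply/funext => s; rewrite exprS.
by rewrite -(mulr0 0); exact: ccvg0M ccvg0_it IH.
Qed.

(** The phase [- (pi / 2)] yields the imaginary part since Re(-iz) = Im z. *)
Definition LiC (w : seq bool) (t : R) : R[i] :=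
  (Lphase 0 w t +i* Lphase (- (pi / 2)) w t)%C.

Lemma LiC_nil t : LiC [::] t = 1.
Proof. by rewrite /LiC !Lphase_nil cos0 cosN cos_pihalf. Qed.

Lemma Lphase_opp (p q : R) w (t : R) : (forall s, cos (s + p) = - cos (s + q)) -> 0 < t < pi ->
  Lphase p w t = - Lphase q w t.
Proof.
move=> H tp; apply: cvg_lim => //.
have L : - Lpart q w t N @[N --> \oo] --> - Lphase q w t.
  by apply: cvgN; exact: Lphase_cvg.
apply: cvg_trans L; apply: near_eq_cvg; apply: nearW => N; rewrite /Lpart /= -sumrN.
by apply: eq_bigr => m _; rewrite H mulrN.
Qed.

Lemma LiC_derive w t : w != [::] -> 0 < t < pi ->
  cderive (LiC (false :: w)) t ('i%C * LiC w t).
Proof.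
move=> w0 tp; split.
  rewrite ReCM /= mul0r mul1r sub0r.
  apply: is_derive_eq (Lphase_derive 0 w0 tp) _; rewrite add0r.
  by apply: Lphase_opp => // s; rewrite cosDpihalf cosBpihalf.
rewrite ImCM /= mul0r mul1r add0r.
by apply: is_derive_eq (Lphase_derive _ w0 tp) _; rewrite addNr.
Qed.

Lemma LiC_at0 w : ccvg0 (LiC (false :: w)) (LiC (false :: w) 0).
Proof. by split; exact: Lphase_false_at0. Qed.

Lemma LiC_shuffle1 w t : wvalid w -> 0 < t < pi ->
  LiC [:: true] t * LiC w t = \sum_(v <- wshuffle1 w) LiC v t.
Proof.
move=> vw tp.
have E r : \sum_(v <- r) LiC v t = ((\sum_(v <- r) Lphase 0 v t) +i*
    (\sum_(v <- r) Lphase (- (pi / 2)) v t))%C.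
  elim: r => [|v r IH]; first by rewrite !big_nil.
  by rewrite !big_cons IH; apply: complex_eqP; rewrite ?ReCD ?ImCD.
rewrite E; apply: complex_eqP; rewrite ?ReCM ?ImCM /= -(Lphase_shuffle1 _ vw tp).
  by rewrite sub0r.
congr (_ + _); rewrite -[RHS]mulrN; congr (_ * _).
rewrite (@Lphase_opp (- (pi / 2) - pi / 2) 0) // => [|s]; first by rewrite opprK.
by rewrite addrA cosBpihalf addr0 sinBpihalf.
Qed.

(** The last two terms cancel the imaginary part (pi - t)/2 of Li_1. The halves are images of
    rationals, so that the closure of the graded spans under rational multiples applies. *)
Lemma Afun_LiC t : 0 < t < pi ->
  (Afun t)%:C = - LiC [:: true] t + (ratr 2^-1)%:C * ('i%C * pi%:C) - (ratr 2^-1)%:C * it t.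
Proof.
move=> tp; rewrite /LiC Lphase_one_re // Lphase_one_im // fmorphV /= ratr_nat.
apply: complex_eqP; rewrite /it !(ReCD, ImCD) /=.
  by rewrite !(mul0r, mulr0, mul1r, subr0, addr0, oppr0) opprK.
by rewrite !(mul0r, mulr0, mul1r, subr0, addr0, add0r); field.
Qed.

End ComplexValues.

(** * From words to indices *)

Section IndexWords.
Variable R : realType.

(* The word of the index whose entries, last one first, are [ks]. *)
Fixpoint index_word (ks : seq nat) : seq bool :=
  if ks is k :: ks' then nseq k.-1 false ++ true :: index_word ks' else [::].

(** A letter [true] opens a new entry 1, a letter [false] raises the outermost entry by one;
    validity ensures that there is an entry to raise. *)
Lemma index_word_exists w : wvalid w -> exists ks : seq nat,
  [/\ all (fun k => (0 < k)%N) ks, w = index_word ks, sumn ks = size w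
    & size ks = count id w].
Proof.
elim: w => [_|[] w IH vw]; first by exists [::].
  have [|ks [pk -> sk ck]] := IH; first by case: (w) vw.
  by exists (1%N :: ks); split => //=; rewrite ?add1n ?sk ?ck.
have vw' : wvalid w by case: (w) vw.
have [ks [pk wE sk ck]] := IH vw'.
case: ks pk wE sk ck => [|k ks] /= pk wE sk ck; first by rewrite wE in vw.
move: pk => /andP[k0 pk]; exists (k.+1 :: ks); split => //=.
- by rewrite wE; case: (k) k0.
- by rewrite -sk addSn.
Qed.

Lemma wcoef_nseq_false j w m : (0 < m)%N ->
  wcoef R (nseq j false ++ w) m = m%:R ^- j * wcoef R w m.
Proof.
move=> m0; elim: j => [|j IH]; first by rewrite expr0 invr1 mul1r.
by rewrite [LHS]/= IH exprS invfM; ring.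
Qed.

Lemma sum_wcoef_index_word ks m : all (fun k => (0 < k)%N) ks -> (0 < m)%N ->
  \sum_(q < m) wcoef R (index_word ks) q = zt_rev R ks m.
Proof.
elim: ks m => [|k ks IH] m pk m0.
  by case: m m0 => // m _; rewrite big_ord_recl /= big1 ?addr0.
have /andP[k0 pks] := pk.
rewrite -(big_mkord xpredT) big_ltn // [index_word _]/=.
have -> : wcoef R (nseq k.-1 false ++ true :: index_word ks) 0 = 0.
  by case: (k.-1) => [|j]; rewrite ?cat0s wcoef_cons0.
rewrite add0r [RHS]/= !big_nat; apply: eq_bigr => q /andP[q0 _].
rewrite wcoef_nseq_false // [wcoef R (true :: _) _]/= IH //.
by rewrite -[in RHS](prednK k0) exprS invfM; ring.
Qed.

Lemma wcoef_index_word k ks m : all (fun k => (0 < k)%N) (k :: ks) -> (0 < m)%N ->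
  wcoef R (index_word (k :: ks)) m = m%:R ^- k * zt_rev R ks m.
Proof.
move=> /andP[k0 pks] m0.
rewrite [index_word _]/= wcoef_nseq_false // [wcoef R (true :: _) _]/=.
rewrite sum_wcoef_index_word // -[in RHS](prednK k0) exprS invfM; ring.
Qed.

Lemma Lpart_index_word p k ks t N : all (fun k => (0 < k)%N) (k :: ks) ->
  Lpart p (index_word (k :: ks)) t N
  = \sum_(1 <= m < N) cos (m%:R * t + p) * m%:R ^- k * zt_rev R ks m.
Proof.
move=> pk; rewrite /Lpart.
rewrite -(big_mkord xpredT (fun m => wcoef R (index_word (k :: ks)) m * cos (m%:R * t + p))).
case: N => [|N]; first by rewrite !big_geq.
rewrite big_ltn // [index_word _]/=.
have -> : wcoef R (nseq k.-1 false ++ true :: index_word ks) 0 = 0.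
  by case: (k.-1) => [|j]; rewrite ?cat0s wcoef_cons0.
rewrite mul0r add0r !big_nat; apply: eq_bigr => q /andP[q0 _].
by rewrite (wcoef_index_word pk) // -mulrA mulrC.
Qed.

End IndexWords.

(** * Log-sine integrals as polylogarithmic functions *)

Section PolylogFunctions.
Variable R : realType.
Local Open Scope complex_scope.
Local Notation ReC := complex.Re.
Local Notation ImC := complex.Im.

Hypothesis mzv_span :
  forall ks : seq nat, all (fun k => (0 < k)%N) ks -> admissible ks ->
     inspanQ (@S'_set R (sumn ks) (size ks)) (mzv R ks).
Hypothesis polylog_span :
  forall ks : seq nat, all (fun k => (0 < k)%N) ks ->
     inspanQ (@So_set R (sumn ks) (size ks)) (Cl ks (pi / 3)) /\
     inspanQ (@Se_set R (sumn ks) (size ks)) (Gl ks (pi / 3)).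

(** Hypothesis (B) in graded form: the real part is Cl in odd weight and Gl in even weight, so its
    depth parity is always that of the weight. *)
Lemma LiC_homog w : wvalid w ->
  homog (size w) (count id w) (LiC w (pi / 3) : R[i]).
Proof.
move=> /index_word_exists[ks [pk wE <- <-]].
case: ks pk wE => [|k ks] pk ->; first by rewrite LiC_nil; exact: homog1.
have pr : all (fun k => (0 < k)%N) (rev (k :: ks)) by rewrite all_rev.
have [hC hG] := polylog_span pr.
have ReE : ReC (LiC (index_word (k :: ks)) (pi / 3 : R)) = Li_re (rev (k :: ks)) (pi / 3).
  have E : Lpart 0 (index_word (k :: ks)) (pi / 3) = (fun N => \sum_(1 <= m < N)
      (cos (m%:R * (pi / 3)) * m%:R ^- k * zt_rev R ks m)).
    by apply/funext => N; rewrite Lpart_index_word //; under eq_bigr do rewrite addr0.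
  by rewrite /Li_re revK -E.
have ImE : ImC (LiC (index_word (k :: ks)) (pi / 3 : R)) = Li_im (rev (k :: ks)) (pi / 3).
  have E : Lpart (- (pi / 2)) (index_word (k :: ks)) (pi / 3) = (fun N => \sum_(1 <= m < N)
      (sin (m%:R * (pi / 3)) * m%:R ^- k * zt_rev R ks m)).
    by apply/funext => N; rewrite Lpart_index_word //; under eq_bigr do rewrite cosBpihalf.
  by rewrite /Li_im revK -E.
move: hC hG; rewrite sumn_rev size_rev /Cl /Gl sumn_rev /homog ReE ImE.
have So x : inspanQ (So_set (sumn (k :: ks)) (size (k :: ks))) x ->
    inspanQ (@Sset R true (sumn (k :: ks)) (size (k :: ks))) x.
  by apply: inspanQ_sub => y /So_Sset; exact: inspanQ_gen.
have Se x : inspanQ (Se_set (sumn (k :: ks)) (size (k :: ks))) x ->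
    inspanQ (@Sset R false (sumn (k :: ks)) (size (k :: ks))) x.
  by apply: inspanQ_sub => y /Se_Sset; exact: inspanQ_gen.
by case: ifP => _ /So hC /Se hG; split.
Qed.

(** At [t = 0] the sines vanish and the real part is a multiple zeta value; the leading [false]
    makes the last entry at least 2, so (A) applies. *)
Lemma LiC_homog_at0 w : w != [::] -> wvalid w ->
  homog (size w).+1 (count id w) (LiC (false :: w) 0 : R[i]).
Proof.
move=> w0 vw.
have vw' : wvalid (false :: w) by case: (w) vw w0.
have [ks [pk wE sk ck]] := index_word_exists vw'.
case: ks pk wE sk ck => [|k ks] // pk wE sk ck.
have k2 : (1 < k)%N.
  by move: wE => /=; case: (k) => [|[|]].
have pr : all (fun k => (0 < k)%N) (rev (k :: ks)) by rewrite all_rev.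
have ad : admissible (rev (k :: ks)) by rewrite /admissible rev_cons last_rcons.
have := mzv_span pr ad; rewrite sumn_rev size_rev sk ck /= add0n => hz.
split.
  apply: inspanQ_sub (_ : inspanQ (@S'_set R (size w).+1 (count id w)) _).
    by move=> y /S'_Sset; exact: inspanQ_gen.
  suff -> : ReC (LiC (false :: w) 0) = mzv R (rev (k :: ks)) by [].
  have E : Lpart 0 (index_word (k :: ks)) 0 = zt_rev R (k :: ks).
    apply/funext => N; rewrite Lpart_index_word //=; apply: eq_bigr => m _.
    by rewrite mulr0 addr0 cos0 mul1r.
  by rewrite /mzv revK wE -E.
suff -> : ImC (LiC (false :: w) 0) = 0 :> R by exact: inspanQ0.
apply: cvg_lim => //; apply: cvg_near_cst; apply: nearW => N.
by rewrite /Lpart big1 // => m _; rewrite mulr0 add0r cosN cos_pihalf mulr0.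
Qed.

(* Finite sums of functions [c (it)^b Li_v(e^(it))] on ]0, pi / 2[, with
   homogeneous constants [c] and of total weight [w]. *)
Inductive polylog_fun : nat -> nat -> (R -> R[i]) -> Prop :=
| polylog_gen a b d e c v f : homog a e c -> wvalid v ->
    (e + count id v <= d)%N ->
    (forall t, 0 < t < pi / 2 -> f t = c * it t ^+ b * LiC v t) ->
    polylog_fun (a + b + size v) d f
| polylog_add w d f g h : polylog_fun w d f -> polylog_fun w d g ->
    (forall t, 0 < t < pi / 2 -> h t = f t + g t) -> polylog_fun w d h.

Lemma polylog_intro w a b d e c v f : homog a e c -> wvalid v ->
  (e + count id v <= d)%N -> (a + b + size v)%N = w ->
  (forall t, 0 < t < pi / 2 -> f t = c * it t ^+ b * LiC v t) ->
  polylog_fun w d f.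
Proof. by move=> hc vv de <- fE; exact: (polylog_gen hc vv de fE). Qed.

Lemma polylog_ext w d f g : polylog_fun w d f ->
  (forall t, 0 < t < pi / 2 -> f t = g t) -> polylog_fun w d g.
Proof.
move=> [a b d' e c v f' hc vv de fE fg|w' d' f1 g1 h pf pg hE hg].
  by apply: (polylog_gen hc vv de) => t tp; rewrite -fg // fE.
by apply: (polylog_add pf pg) => t tp; rewrite -hg // hE.
Qed.

Lemma polylog_mono w d d' f : (d <= d')%N -> polylog_fun w d f -> polylog_fun w d' f.
Proof.
move=> dd pf; elim: pf d' dd => {w d f}.
  move=> a b d e c v f hc vv de fE d' dd.
  by apply: (polylog_gen hc vv _ fE); exact: leq_trans dd.
move=> w d f g h _ IHf _ IHg hE d' dd.
by apply: (polylog_add (IHf _ dd) (IHg _ dd) hE).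
Qed.

Lemma polylog_weight w w' d f : w = w' -> polylog_fun w d f -> polylog_fun w' d f.
Proof. by move=> ->. Qed.

Lemma polylog_cmul a e c w d f : homog a e c -> polylog_fun w d f ->
  polylog_fun (a + w) (e + d) (fun t => c * f t).
Proof.
move=> hc; elim=> {w d f}.
  move=> a' b d e' c' v f hc' vv de fE.
  apply: (polylog_intro (homogM hc hc') vv) => [| |t tp].
  - by rewrite -addnA leq_add2l.
  - by rewrite -!addnA.
  - by rewrite fE // !mulrA.
move=> w d f g h _ IHf _ IHg hE; apply: (polylog_add IHf IHg) => t tp.
by rewrite hE // mulrDr.
Qed.

Lemma polylog_zmul (q : rat) w d f : polylog_fun w d f ->
  polylog_fun w d (fun t => (ratr q)%:C * f t).
Proof.
move=> pf; have := polylog_cmul (homogZ q (homog1 R)) pf.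
by rewrite mulr1.
Qed.

Lemma polylog_it w d f : polylog_fun w d f ->
  polylog_fun w.+1 d (fun t => it t * f t).
Proof.
elim=> {w d f}.
  move=> a b d e c v f hc vv de fE.
  apply: (polylog_intro (b := b.+1) hc vv de) => [|t tp].
  - by rewrite addnS addSn.
  - by rewrite fE // exprS; ring.
move=> w d f g h _ IHf _ IHg hE; apply: (polylog_add IHf IHg) => t tp.
by rewrite hE // mulrDr.
Qed.

Lemma polylog_sum (I : eqType) (r : seq I) w d (F : I -> R -> R[i]) :
  (forall i, i \in r -> polylog_fun w d (F i)) ->
  polylog_fun w d (fun t => \sum_(i <- r) F i t).
Proof.
elim: r => [|i r IH] H.
  apply: (polylog_intro (b := 0) (homog0 R w 0) (isT : wvalid [::]) (leq0n d)) => [|t _].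
    by rewrite !addn0.
  by rewrite big_nil !mul0r.
apply: (polylog_add (H i _) (IH _)) => [|j jr|t _]; first by rewrite mem_head.
  by apply: H; rewrite inE jr orbT.
by rewrite big_cons.
Qed.

Lemma half_pi_itv (t : R) : 0 < t < pi / 2 -> 0 < t < pi.
Proof. by have := pi_gt0 R; move=> ? /andP[t0 tp]; rewrite t0 /=; lra. Qed.

(** Only the shuffle with Li_1 raises the depth; the corrections i pi/2 and it/2 raise the weight
    alone. *)
Lemma polylog_Afun w d f : polylog_fun w d f ->
  polylog_fun w.+1 d.+1 (fun t => (Afun t)%:C * f t).
Proof.
elim=> {w d f}; last first.
  move=> w d f g h _ IHf _ IHg hE; apply: (polylog_add IHf IHg) => t tp.
  by rewrite hE // mulrDr.
move=> a b d e c v f hc vv de fE.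
have pf : polylog_fun (a + b + size v) d f by exact: (polylog_gen hc vv de fE).
have p1 : polylog_fun (a + b + size v).+1 d.+1
    (fun t => \sum_(u <- wshuffle1 v) c * it t ^+ b * LiC u t).
  apply: polylog_sum => u /(wshuffle1_spec vv)[vu _ su cu].
  apply: (polylog_intro (b := b) hc vu) => //; first by rewrite cu addnS ltnS.
  by rewrite su addnS.
have p2 := polylog_mono (leqnSn d) (polylog_zmul (2^-1) (polylog_cmul (homog_ipi R) pf)).
have p3 := polylog_mono (leqnSn d) (polylog_zmul (- 2^-1) (polylog_it pf)).
have p12 : polylog_fun (a + b + size v).+1 d.+1 (fun t =>
    (ratr (-1))%:C * (\sum_(u <- wshuffle1 v) c * it t ^+ b * LiC u t)
    + (ratr 2^-1)%:C * ('i%C * pi%:C * f t)).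
  by apply: (polylog_add (polylog_zmul (-1) p1) p2).
apply: (polylog_add p12 p3) => t tp.
have tp' := half_pi_itv tp.
rewrite -mulr_sumr -(LiC_shuffle1 vv tp') (Afun_LiC tp') fE //.
by rewrite !ratrC_opp (ratrC_nat R 1); ring.
Qed.

(** At [pi / 3] the factor [it] is a third of i pi, of weight 1 and depth 0, so powers of it cost no
    depth. *)
Lemma polylog_eval w d f : polylog_fun w d f -> homog w d (f (pi / 3)).
Proof.
elim=> {w d f}.
  move=> a b d e c v f hc vv de fE; rewrite fE; last exact: pi3_itv.
  apply: (homog_mono de); apply: homogM; last exact: LiC_homog.
  rewrite -[e]addn0; apply: homogM => //.
  have -> : it (pi / 3) = (ratr 3^-1)%:C * ('i%C * pi%:C) :> R[i].
    by rewrite ratrC_inv ratrC_nat /it rmorphM fmorphV rmorph_nat; ring.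
  by have := homogX b (homogZ 3^-1 (homog_ipi R)); rewrite muln1.
move=> w d f g h _ IHf _ IHg hE; rewrite hE; last exact: pi3_itv.
exact: homogD.
Qed.

(** A primitive with respect to d(it) rather than dt: the factor i keeps integration compatible with
    the parity grading. *)
Definition primitive_fun g f : Prop :=
  (forall t : R, 0 < t < pi / 2 -> cderive g t ('i%C * f t)) /\ ccvg0 g 0.

Lemma primitive_ext g f f' : (forall t, 0 < t < pi / 2 -> f t = f' t) ->
  primitive_fun g f -> primitive_fun g f'.
Proof. by move=> ff [gd g0]; split => // t tp; rewrite -ff //; exact: gd. Qed.

Lemma primitive_add g f g' f' : primitive_fun g f -> primitive_fun g' f' ->
  primitive_fun (fun t => g t + g' t) (fun t => f t + f' t).
Proof.
move=> [gd g0] [gd' g0']; split; last by rewrite -(addr0 0); exact: ccvg0D.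
by move=> t tp; rewrite mulrDr; apply: cderiveD; [exact: gd|exact: gd'].
Qed.

(* Repeated integration by parts: [i Li_w] has the primitive [Li_(x0 w)]. *)
Lemma primitive_gen a b e c v : homog a e c -> wvalid v -> v != [::] ->
  exists2 g, polylog_fun (a + b + size v).+1 (e + count id v) g
    & primitive_fun g (fun t => c * it t ^+ b * LiC v t).
Proof.
elim: b c v => [|b IH] c v hc vv v0.
  have vv' : wvalid (false :: v) by case: (v) vv v0.
  (* The value at 0 is subtracted so that the primitive tends to 0; as a term with the empty word it
     is homogeneous by (A). *)
  exists (fun t => c * LiC (false :: v) t + (ratr (-1))%:C * (c * LiC (false :: v) 0)).
    have p1 : polylog_fun (a + 0 + size v).+1 (e + count id v)
        (fun t => c * LiC (false :: v) t).
      apply: (polylog_intro (b := 0) hc vv') => [//||t _]; first by rewrite addnS.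
      by rewrite expr0 mulr1.
    have p2 : polylog_fun (a + 0 + size v).+1 (e + count id v)
        (fun t => (ratr (-1))%:C * (c * LiC (false :: v) 0)).
      have hz : homog (a + (size v).+1) (e + count id v)
          ((ratr (-1))%:C * (c * LiC (false :: v) 0)).
        by apply: homogZ; apply: homogM => //; exact: LiC_homog_at0.
      apply: (polylog_intro (b := 0) hz (isT : wvalid [::])) => [||t _].
      - by rewrite addn0.
      - by rewrite !addn0 addnS.
      - by rewrite expr0 mulr1 LiC_nil mulr1.
    exact: polylog_add p1 p2 (fun t _ => erefl).
  split.
    move=> t tp.
    have -> : 'i%C * (c * it t ^+ 0 * LiC v t) = c * ('i%C * LiC v t) + 0.
      by rewrite expr0; ring.
    exact: (cderiveD (cderiveZ c (LiC_derive v0 (half_pi_itv tp))) (cderive_cst _ t)).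
  have -> : 0 = c * LiC (false :: v) 0 + (ratr (-1))%:C * (c * LiC (false :: v) 0).
    by rewrite ratrC_opp (ratrC_nat R 1) mulN1r subrr.
  apply: ccvg0D; last exact: ccvg0_cst.
  by apply: ccvg0M; [exact: ccvg0_cst|exact: LiC_at0].
have vv' : wvalid (false :: v) by case: (v) vv v0.
have hc' : homog a e ((ratr (- b.+1%:R))%:C * c) by exact: homogZ.
have [g pg [gd g0]] := IH _ (false :: v) hc' vv' isT.
exists (fun t => c * it t ^+ b.+1 * LiC (false :: v) t + g t).
  have p1 : polylog_fun (a + b.+1 + size v).+1 (e + count id v)
      (fun t => c * it t ^+ b.+1 * LiC (false :: v) t).
    by apply: (polylog_intro (b := b.+1) hc vv') => //=; lia.
  apply: polylog_add p1 (polylog_weight _ pg) (fun t _ => erefl).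
  by rewrite /= !addnS !addSn.
split; last first.
  rewrite -(addr0 0); apply: ccvg0D => //.
  rewrite -(mul0r (LiC (false :: v) 0)) -(mulr0 c); apply: ccvg0M; last exact: LiC_at0.
  by apply: ccvg0M; [exact: ccvg0_cst|exact: ccvg0_itX].
move=> t tp; have tp' := half_pi_itv tp.
have D1 := cderiveM (cderiveZ c (cderive_itX b t)) (LiC_derive v0 tp').
have := cderiveD D1 (gd t tp); congr (cderive _ _ _).
by rewrite ratrC_opp ratrC_nat; ring.
Qed.

Lemma polylog_primitive w d f : polylog_fun w d f ->
  exists2 g, polylog_fun w.+1 d g & primitive_fun g f.
Proof.
elim=> {w d f}; last first.
  move=> w d f g h _ [f' pf' ff'] _ [g' pg' gg'] hE.
  exists (fun t => f' t + g' t); first exact: polylog_add pf' pg' (fun t _ => erefl).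
  apply: primitive_ext (primitive_add ff' gg') => t tp.
  by rewrite hE.
move=> a b d e c v f hc vv de fE.
have [v0|v0] := eqVneq v [::]; last first.
  have [g pg gg] := primitive_gen b hc vv v0.
  exists g; first exact: polylog_mono pg.
  by apply: primitive_ext gg => t tp; rewrite fE.
(* For the empty word [false] cannot be prefixed, the result being invalid; the power of [it] is
   integrated directly. *)
have hc' : homog a e ((ratr b.+1%:R^-1)%:C * c) by exact: homogZ.
exists (fun t => (ratr b.+1%:R^-1)%:C * c * it t ^+ b.+1).
  apply: (polylog_intro (b := b.+1) hc' (isT : wvalid [::])) => [||t _].
  - by move: de; rewrite v0.
  - by rewrite v0 /= !addn0 addnS.
  - by rewrite LiC_nil mulr1.
split; last first.
  rewrite -(mulr0 ((ratr b.+1%:R^-1)%:C * c)).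
  by apply: ccvg0M; [exact: ccvg0_cst|exact: ccvg0_itX].
move=> t tp; have := cderiveZ ((ratr b.+1%:R^-1)%:C * c) (cderive_itX b t).
congr (cderive _ _ _); rewrite fE // v0 LiC_nil ratrC_inv ratrC_nat.
have : b.+1%:R != 0 :> R[i] by rewrite pnatr_eq0.
by move=> ?; field.
Qed.

Definition lsphi (kl : nat * nat) (t : R) : R :=
  t ^+ kl.2 * Afun t ^+ (kl.1 - 1 - kl.2)%N.

Lemma lsphi_singular kl : singular (lsphi kl).
Proof.
have := singular_log_sine (0 : R) kl.2 (kl.1 - 1 - kl.2).
by congr singular; apply/funext => t; rewrite subr0.
Qed.

Lemma polylog_itX n w d f : polylog_fun w d f ->
  polylog_fun (n + w) d (fun t => it t ^+ n * f t).
Proof.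
move=> pf; elim: n => [|n IH]; first by apply: polylog_ext pf _ => t _; rewrite expr0 mul1r.
by apply: polylog_ext (polylog_it IH) _ => t _; rewrite exprS mulrA.
Qed.

Lemma polylog_AfunX n w d f : polylog_fun w d f ->
  polylog_fun (n + w) (n + d) (fun t => (Afun t ^+ n)%:C * f t).
Proof.
move=> pf; elim: n => [|n IH]; first by apply: polylog_ext pf _ => t _; rewrite expr0 mul1r.
by apply: polylog_ext (polylog_Afun IH) _ => t _; rewrite exprS rmorphM mulrA.
Qed.

(** Each level brings i^l from the power of [it] and one more i from the integration. The weight
    grows by (k-1-l) + l + 1 = k and the depth by k-1-l. *)
Lemma log_sine_polylog (js : seq (nat * nat)) :
  all (fun kl => kl.2 + 1 <= kl.1)%N js ->
  polylog_fun (\sum_(kl <- js) kl.1)%N (\sum_(kl <- js) (kl.1 - 1 - kl.2))%N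
    (fun t => 'i%C ^+ (\sum_(kl <- js) kl.2.+1)%N * (iterI lsphi js t)%:C).
Proof.
elim: js => [_|[k l] js IH] /=.
  rewrite !big_nil; apply: (polylog_intro (b := 0) (homog1 R) (isT : wvalid [::])) => // t _.
  by rewrite LiC_nil !expr0 !mul1r.
move=> /andP[lk /IH {}IH]; rewrite !big_cons.
set w := (\sum_(kl <- js) kl.1)%N in IH *; set d := (\sum_(kl <- js) (kl.1 - 1 - kl.2))%N in IH *.
set e := (\sum_(kl <- js) kl.2.+1)%N in IH *; rewrite [(k, l).1]/= [(k, l).2]/=.
have pf := polylog_itX l (polylog_AfunX (k - 1 - l) IH).
have [g pg [gd [g1 g2]]] := polylog_primitive pf.
have E t : 'i%C * (it t ^+ l * ((Afun t ^+ (k - 1 - l))%:C * ('i%C ^+ e * (iterI lsphi js t)%:C)))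
    = 'i%C ^+ (l.+1 + e) * (lsphi (k, l) t * iterI lsphi js t)%:C.
  rewrite /it /lsphi exprMn exprD exprS /= !rmorphM !rmorphXn /=; ring.
apply: polylog_ext (polylog_weight _ pg) _.
  by move: lk => /=; lia.
move=> t tp.
have D s (c : R) : 0 < s < pi / 2 -> is_derive s (1 : R)
   (fun u => c * iterI lsphi ((k, l) :: js) u) (c * (lsphi (k, l) s * iterI lsphi js s)).
  by move=> sp; apply: is_derive_scale; exact: (iterI_derive lsphi_singular).
have L (c : R) : c * iterI lsphi ((k, l) :: js) u @[u --> 0^'+] --> 0.
  rewrite -[X in _ --> X](mulr0 c); apply: cvgM; first exact: cvg_cst.
  exact: (iterI_at0 lsphi_singular).
apply: complex_eqP.
  transitivity (ReC ('i%C ^+ (l.+1 + e) : R[i]) * iterI lsphi ((k, l) :: js) t); last first.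
    by rewrite ReCM /= mulr0 subr0.
  apply: (derive_unique _ (D ^~ _) g1 (L _)) tp => s sp.
  by have [gs _] := gd s sp; apply: is_derive_eq gs _; rewrite E ReCM /= mulr0 subr0.
transitivity (ImC ('i%C ^+ (l.+1 + e) : R[i]) * iterI lsphi ((k, l) :: js) t); last first.
  by rewrite ImCM /= mulr0 add0r.
apply: (derive_unique _ (D ^~ _) g2 (L _)) tp => s sp.
by have [_ gs] := gd s sp; apply: is_derive_eq gs _; rewrite E ImCM /= mulr0 add0r.
Qed.

(** Up to sign [x] is the real part if [e] is even and the imaginary part if [e] is odd; as
    [w = e + d], the parity attached to that part is [odd d] in both cases. *)
Lemma homog_i_real w d e (x : R) : (e + d)%N = w ->
  homog w d ('i%C ^+ e * x%:C) -> inspanQ (@Sset R (odd d) w d) x.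
Proof.
move=> wE; have -> : 'i%C ^+ e = (-1) ^+ (e./2) * 'i%C ^+ odd e :> R[i].
  by rewrite -[in LHS](odd_double_half e) exprD -mul2n exprM sqr_i mulrC.
have pm (z : R[i]) : homog w d ((-1) ^+ e./2 * z) -> homog w d z.
  elim: (e./2) => [|n IH]; first by rewrite expr0 mul1r.
  rewrite exprS -mulrA => /(homogZ (-1)).
  by rewrite ratrC_opp (ratrC_nat R 1) !mulN1r opprK.
rewrite -mulrA => /pm [h1 h2]; move: h1 h2; rewrite -wE oddD.
case: (odd e); rewrite ?expr1 ?expr0 ReCM ImCM /=.
  by move=> _; rewrite mul0r mul1r add0r negbK.
by rewrite mul1r mul0r subr0.
Qed.

End PolylogFunctions.

Theorem theorem10 (R : realType) :
  (* (A) *)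
  (forall ks : seq nat, all (fun k => (0 < k)%N) ks -> admissible ks ->
     inspanQ (@S'_set R (sumn ks) (size ks)) (mzv R ks)) ->
  (* (B) *)
  (forall ks : seq nat, all (fun k => (0 < k)%N) ks ->
     inspanQ (@So_set R (sumn ks) (size ks)) (Cl ks (pi / 3)) /\
     inspanQ (@Se_set R (sumn ks) (size ks)) (Gl ks (pi / 3))) ->
  forall ks ls : seq nat,
    size ks = size ls ->
    (forall u : nat, (u < size ks)%N -> (nth 0 ls u + 1 <= nth 0 ks u)%N) ->
    let d := (\sum_(u < size ks) (nth 0 ks u - 1 - nth 0 ls u))%N in
    (odd d -> inspanQ (@So_set R (sumn ks) d) (Ls ks ls (pi / 3))) /\
    (~~ odd d -> inspanQ (@Se_set R (sumn ks) d) (Ls ks ls (pi / 3))).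
Proof.
move=> hA hB ks ls sz lk d.
(* [iterI] lists integrands from the outermost one, which is the last entry of the index. *)
pose js := rev (zip ks ls).
have jsP : all (fun kl => kl.2 + 1 <= kl.1)%N js.
  rewrite all_rev; apply/(all_nthP (0, 0)%N) => u; rewrite size_zip -sz minnn => us.
  by rewrite nth_zip //= lk.
have wE : (\sum_(kl <- js) kl.1)%N = sumn ks.
  rewrite (perm_big (zip ks ls)) /=; last by rewrite perm_rev.
  by rewrite -(big_map fst xpredT id) -/(unzip1 _) unzip1_zip ?sz // -sumnE.
have dE : (\sum_(kl <- js) (kl.1 - 1 - kl.2))%N = d.
  rewrite (perm_big (zip ks ls)) /=; last by rewrite perm_rev.
  rewrite (big_nth (0, 0)%N) size_zip -sz minnn big_mkord; apply: eq_bigr => u _.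
  by rewrite nth_zip.
(* Entrywise (l + 1) + (k - 1 - l) = k; with truncated subtraction this rests on l + 1 <= k. *)
have eE : ((\sum_(kl <- js) kl.2.+1) + d)%N = sumn ks.
  rewrite -wE -dE -big_split !big_seq; apply: eq_bigr => kl klj /=.
  by have := allP jsP kl klj; lia.
have h := polylog_eval hB (log_sine_polylog hA jsP).
rewrite wE dE in h.
have := homog_i_real eE h.
have -> : Ls ks ls (pi / 3) = (-1) ^+ size ks * iterI (@lsphi R) js (pi / 3).
  by rewrite /Ls /iter_int /iterI /js map_rev.
have Z P (x : R) n : inspanQ P x -> inspanQ P ((-1) ^+ n * x).
  move=> Px; elim: n => [|n IH]; first by rewrite expr0 mul1r.
  by rewrite exprS mulN1r mulNr; exact: inspanQN.
case: (odd d) => H; split => // _; apply: Z; apply: inspanQ_sub H => y Sy.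
  by apply: inspanQ_gen; exact: Sset_So.
by apply: inspanQ_gen; exact: Sset_Se.
Qed.
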